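(* For each ordinal $\alpha$, there exists a Bézout domain $R$ with Krull dimension $1$ such that $\Gamma(R)_\infty^+$ has m-dimension $\alpha$.
   Context: A Bézout domain is an integral domain whose finitely generated ideals are principal. Krull dimension is the maximal length of chains of prime ideals. Value group: for a Bézout domain $R$ with field of fractions $Q$, $\Gamma(R)=Q^\times/R^\times$ ordered by $aR^\times\leq bR^\times$ iff $bR\subseteq aR$; it is a lattice ordered abelian group. $\Gamma^+$ is the positive cone of $\Gamma$, and $\Gamma_\infty^+=\Gamma^+\cup\{\infty\}$ with $\infty$ a new top element. m-dimension: for a bounded modular lattice $L$, let $\sim$ be the smallest congruence identifying the endpoints of every interval with at most two elements. Put $L_0=L$, $L_{\alpha+1}=L_\alpha/\!\sim$, and for limit $\lambda$ let $L_\lambda$ be the quotient of $L$ by the union of the kernels of $L\to L_\alpha$, $\alpha<\lambda$. If $L$ has at least two elements and some $L_\alpha$ is a one-point lattice, then the least such $\alpha$ is a successor and the m-dimension of $L$ is $\alpha-1$; if no $L_\alpha$ is a one-point lattice then $L$ does not have m-dimension.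
   Formalization: The ordinal α is assumed to be nonzero: for a Bézout domain of Krull dimension 1 the positive cone of the value group has no largest element, so ∞ is not identified with any finite value in the first step and the m-dimension cannot be 0. *)

(* Defs.v *)
From HB Require Import structures.
From mathcomp Require Import all_boot all_order all_algebra.
From mathcomp Require Import ring boolp wochoice.

Set Implicit Arguments.
Unset Strict Implicit.
Unset Printing Implicit Defensive.

Import Order.TTheory GRing.Theory.
Local Open Scope ring_scope.
Local Open Scope order_scope.
Local Open Scope quotient_scope.

Variant topped (T : Type) := Below of T | Topmost.
Arguments Below {T} _.
Arguments Topmost {T}.

Definition option_of_topped T (x : topped T) : option T :=
  if x is Below a then Some a else None.

Definition topped_of_option T (x : option T) : topped T :=
  if x is Some a then Below a else Topmost.

Fact option_of_toppedK T : cancel (@option_of_topped T) (@topped_of_option T).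
Proof. by case. Qed.

HB.instance Definition _ (T : choiceType) :=
  Choice.copy (topped T) (can_type (@option_of_toppedK T)).

Section ToppedPOrder.
Context {d : Order.disp_t} {T : porderType d}.

Definition topped_le (x y : topped T) : bool :=
  match x, y with
  | _, Topmost => true
  | Topmost, Below _ => false
  | Below a, Below b => a <= b
  end.

Fact topped_le_refl : reflexive topped_le.
Proof. by case=> [a|] /=. Qed.

Fact topped_le_anti : antisymmetric topped_le.
Proof. by move=> [a|] [b|] //= /le_anti ->. Qed.

Fact topped_le_trans : transitive topped_le.
Proof. by move=> [a|] [b|] [c|] //=; apply: le_trans. Qed.

HB.instance Definition _ := Order.Le_isPOrder.Build d (topped T)
  topped_le_refl topped_le_anti topped_le_trans.

Fact topped_lex1 (x : topped T) : x <= Topmost.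
Proof. by case: x. Qed.

HB.instance Definition _ :=
  Order.hasTop.Build d (topped T) topped_lex1.

End ToppedPOrder.

Section ToppedBottom.
Context {d : Order.disp_t} {T : bPOrderType d}.

Fact topped_le0x (x : topped T) : Below \bot <= x.
Proof. by case: x => [a|] //; exact: (le0x a). Qed.

HB.instance Definition _ :=
  Order.hasBottom.Build d (topped T) topped_le0x.

End ToppedBottom.

Section ToppedLattice.
Context {d : Order.disp_t} {T : latticeType d}.

Definition topped_meet (x y : topped T) : topped T :=
  match x, y with
  | Topmost, _ => y
  | _, Topmost => x
  | Below a, Below b => Below (a `&` b)
  end.

Definition topped_join (x y : topped T) : topped T :=
  match x, y with
  | Below a, Below b => Below (a `|` b)
  | _, _ => Topmost
  end.

Fact topped_meetP (x y z : topped T) :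
  (x <= topped_meet y z) = (x <= y) && (x <= z).
Proof.
by case: x y z => [a|] [b|] [c|] //=; rewrite /Order.le /= ?lexI ?andbT ?andbF.
Qed.

Fact topped_joinP (x y z : topped T) :
  (topped_join x y <= z) = (x <= z) && (y <= z).
Proof.
by case: x y z => [a|] [b|] [c|] //=; rewrite /Order.le /= ?leUx ?andbT ?andbF.
Qed.

HB.instance Definition _ :=
  Order.POrder_MeetJoin_isLattice.Build d (topped T) topped_meetP topped_joinP.

End ToppedLattice.

HB.instance Definition _ d (T : bLatticeType d) := Order.Lattice.on (topped T).

Record congruence {d : Order.disp_t} (L : latticeType d) := Congruence {
  cong_rel :> rel L;
  congP : equiv_class_of cong_rel;
  congI : forall x x' y y', cong_rel x x' -> cong_rel y y' ->
    cong_rel (x `&` y) (x' `&` y');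
  congU : forall x x' y y', cong_rel x x' -> cong_rel y y' ->
    cong_rel (x `|` y) (x' `|` y') }.

Canonical cong_equiv_rel d (L : latticeType d) (K : congruence L) :=
  EquivRelPack (congP K).

Definition cquot {d : Order.disp_t} {L : latticeType d} (K : congruence L) :=
  {eq_quot K}.

Section QuotientLattice.
Context {d : Order.disp_t} {L : latticeType d} (K : congruence L).

HB.instance Definition _ : EqQuotient _ K (cquot K) := EqQuotient.on (cquot K).
HB.instance Definition _ := Choice.on (cquot K).

Definition cquot_meet (u v : cquot K) : cquot K := \pi_(cquot K) (repr u `&` repr v).
Definition cquot_join (u v : cquot K) : cquot K := \pi_(cquot K) (repr u `|` repr v).
Definition cquot_le (u v : cquot K) : bool := cquot_meet u v == u.

Lemma cong_repr (x : L) : K x (repr (\pi_(cquot K) x)).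
Proof. by rewrite -[K _ _]/(equiv (cong_equiv_rel K) _ _) -eqmodE reprK. Qed.

Lemma pi_cquotI (x y : L) :
  \pi_(cquot K) (x `&` y) = cquot_meet (\pi x) (\pi y).
Proof. by apply/eqmodP; apply: congI; apply: cong_repr. Qed.

Lemma pi_cquotU (x y : L) :
  \pi_(cquot K) (x `|` y) = cquot_join (\pi x) (\pi y).
Proof. by apply/eqmodP; apply: congU; apply: cong_repr. Qed.

Fact cquot_meetC : commutative cquot_meet.
Proof. by elim/quotW=> x; elim/quotW=> y; rewrite -!pi_cquotI meetC. Qed.

Fact cquot_joinC : commutative cquot_join.
Proof. by elim/quotW=> x; elim/quotW=> y; rewrite -!pi_cquotU joinC. Qed.

Fact cquot_meetA : associative cquot_meet.
Proof.
by elim/quotW=> x; elim/quotW=> y; elim/quotW=> z; rewrite -!pi_cquotI meetA.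
Qed.

Fact cquot_joinA : associative cquot_join.
Proof.
by elim/quotW=> x; elim/quotW=> y; elim/quotW=> z; rewrite -!pi_cquotU joinA.
Qed.

Fact cquot_joinKI (v u : cquot K) : cquot_meet u (cquot_join u v) = u.
Proof.
by elim/quotW: u => x; elim/quotW: v => y; rewrite -pi_cquotU -pi_cquotI joinKI.
Qed.

Fact cquot_meetKU (v u : cquot K) : cquot_join u (cquot_meet u v) = u.
Proof.
by elim/quotW: u => x; elim/quotW: v => y; rewrite -pi_cquotI -pi_cquotU meetKU.
Qed.

Fact cquot_le_refl : reflexive cquot_le.
Proof. by elim/quotW=> x; rewrite /cquot_le -pi_cquotI meetxx. Qed.

Fact cquot_le_anti : antisymmetric cquot_le.
Proof.
by move=> u v /andP[/eqP uv /eqP vu]; rewrite -uv cquot_meetC vu.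
Qed.

Fact cquot_le_trans : transitive cquot_le.
Proof.
move=> v u w /eqP uv /eqP vw; apply/eqP.
by rewrite -uv -cquot_meetA vw.
Qed.

HB.instance Definition _ := Order.Le_isPOrder.Build d (cquot K)
  cquot_le_refl cquot_le_anti cquot_le_trans.

HB.instance Definition _ := Order.POrder_isLattice.Build d (cquot K)
  cquot_meetC cquot_joinC cquot_meetA cquot_joinA cquot_joinKI cquot_meetKU
  (fun _ _ => erefl).

End QuotientLattice.

Section SmallestCongruence.
Context {d : Order.disp_t} {L : latticeType d} (P : L -> L -> Prop).

Definition smallest_cong_rel : rel L := fun x y =>
  `[< forall K : congruence L, (forall a b, P a b -> K a b) -> K x y >].

Fact smallest_congP : equiv_class_of smallest_cong_rel.
Proof.
split=> [x|x y|y x z].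
- by apply/asboolP=> K _; apply: (equiv_refl (cong_equiv_rel K)).
- by apply/asboolP/asboolP=> xy K /xy; rewrite (equiv_sym (cong_equiv_rel K)).
- move=> /asboolP xy /asboolP yz; apply/asboolP=> K PK.
  exact: (equiv_trans (e := cong_equiv_rel K)) (xy K PK) (yz K PK).
Qed.

Fact smallest_congI x x' y y' :
  smallest_cong_rel x x' -> smallest_cong_rel y y' ->
  smallest_cong_rel (x `&` y) (x' `&` y').
Proof.
move=> /asboolP xx' /asboolP yy'; apply/asboolP=> K PK.
by apply: congI; [apply: xx'|apply: yy'].
Qed.

Fact smallest_congU x x' y y' :
  smallest_cong_rel x x' -> smallest_cong_rel y y' ->
  smallest_cong_rel (x `|` y) (x' `|` y').
Proof.
move=> /asboolP xx' /asboolP yy'; apply/asboolP=> K PK.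
by apply: congU; [apply: xx'|apply: yy'].
Qed.

Definition smallest_cong : congruence L :=
  Congruence smallest_congP smallest_congI smallest_congU.

End SmallestCongruence.

Definition small_interval {d : Order.disp_t} {L : latticeType d} (a b : L) :=
  a <= b /\ exists c e : L, forall x, x \in `[a, b] -> x = c \/ x = e.

Definition msim {d : Order.disp_t} (L : latticeType d) : congruence L :=
  smallest_cong (@small_interval d L).

Definition one_point (T : Type) := exists x : T, forall y : T, y = x.

Section WellOrder.
Context {d : Order.disp_t} {W : orderType d}.

Definition is_zero (w : W) := forall v : W, w <= v.

Definition is_succ (v w : W) := v < w /\ forall u : W, u < w -> u <= v.

Definition is_limit (w : W) :=
  (exists v : W, v < w) /\ forall v : W, v < w -> exists2 u : W, v < u & u < w.

End WellOrder.

Fact topped_le_total d (T : orderType d) :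
  total (<=%O : rel (topped T)).
Proof. by move=> [a|] [b|] //=; exact: (le_total a b). Qed.

HB.instance Definition _ d (T : orderType d) :=
  Order.Lattice_isTotal.Build d (topped T) (@topped_le_total d T).

(* [K w] is the kernel of the projection from [L] onto the [w]-th lattice of
   the m-dimension sequence, so that this lattice is [cquot (K w)]. *)
Definition mdim_kernels {d d' : Order.disp_t} {L : latticeType d}
    {W : orderType d'} (K : W -> congruence L) :=
  [/\ forall w, is_zero w -> forall x y, K w x y <-> x = y,
      forall v w, is_succ v w -> forall x y,
        K w x y <-> msim (cquot (K v)) (\pi x) (\pi y)
    & forall w, is_limit w -> forall x y,
        K w x y <-> exists2 v, v < w & K v x y].

(* The ordinal [alpha] is the order type of [W].  Then [topped (topped W)] is
   the set of ordinals at most [alpha + 1]: the elements of [W] are the ordinals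
   below [alpha], [Below \top] is [alpha] and [\top] is [alpha + 1]. *)
Definition has_mdim {d d' : Order.disp_t} (L : tbLatticeType d)
    (W : orderType d') :=
  (exists x y : L, x != y) /\
  exists K : topped (topped W) -> congruence L,
    [/\ mdim_kernels K,
        one_point (cquot (K \top))
      & forall w, w < \top -> ~ one_point (cquot (K w))].

Definition fg_ideal {R : comNzRingType} (s : seq R) (x : R) :=
  exists c : 'I_(size s) -> R, x = (\sum_i c i * s`_i)%R.

Definition principal_ideal {R : comNzRingType} (a x : R) :=
  exists r : R, x = (r * a)%R.

HB.mixin Record IntegralDomain_isBezout R of GRing.IntegralDomain R := {
  fg_ideal_principal : forall s : seq R,
    exists a : R, forall x : R, fg_ideal s x <-> principal_ideal a x }.

#[short(type="bezoutDomainType")]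
HB.structure Definition BezoutDomain :=
  {R of IntegralDomain_isBezout R & GRing.IntegralDomain R}.

(* [idealr_closed] includes properness. *)
Definition prime_ideal {R : comNzRingType} (P : {pred R}) :=
  idealr_closed P /\ prime_idealr_closed P.

Definition prime_chain {R : comNzRingType} (n : nat) (P : nat -> {pred R}) :=
  (forall i, (i <= n)%N -> prime_ideal (P i)) /\
  (forall i, (i < n)%N ->
     {subset P i <= P i.+1} /\ exists2 x, x \in P i.+1 & x \notin P i).

Definition has_krull_dim (R : comNzRingType) (n : nat) :=
  (exists P : nat -> {pred R}, prime_chain n P) /\
  (forall m (P : nat -> {pred R}), prime_chain m P -> (m <= n)%N).

Notation "x %:F" := (@FracField.tofrac _ x) : ring_scope.

Section ValueGroup.
Variable R : idomainType.

Definition frac_unit := {a : {fraction R} | a != 0%R}.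

Definition gamma_eq (a b : frac_unit) : bool :=
  `[< exists2 u : R, u \is a GRing.unit & val b = (val a * u%:F)%R >].

Fact gamma_eq_refl : reflexive gamma_eq.
Proof.
by move=> a; apply/asboolP; exists 1%R; rewrite ?unitr1 ?rmorph1 ?mulr1.
Qed.

Fact gamma_eq_sym : symmetric gamma_eq.
Proof.
have sym a b : gamma_eq a b -> gamma_eq b a.
  move=> /asboolP[u Uu bE]; apply/asboolP; exists (u^-1)%R.
    by rewrite unitrV.
  by rewrite bE -mulrA -rmorphM divrr // rmorph1 mulr1.
by move=> a b; apply/idP/idP; apply: sym.
Qed.

Fact gamma_eq_trans : transitive gamma_eq.
Proof.
move=> b a c /asboolP[u Uu bE] /asboolP[v Uv cE]; apply/asboolP.
by exists (u * v)%R; rewrite ?unitrM ?Uu // cE bE rmorphM mulrA.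
Qed.

Canonical gamma_equiv :=
  EquivRel gamma_eq gamma_eq_refl gamma_eq_sym gamma_eq_trans.

Definition Gamma := {eq_quot gamma_eq}.

HB.instance Definition _ : EqQuotient _ gamma_eq Gamma := EqQuotient.on Gamma.
HB.instance Definition _ := Choice.on Gamma.

Definition frac_ideal (a x : {fraction R}) := exists r : R, x = (a * r%:F)%R.

Definition frac_le (a b : frac_unit) : bool :=
  `[< forall x, frac_ideal (val b) x -> frac_ideal (val a) x >].

Definition gamma_le (x y : Gamma) : bool := frac_le (repr x) (repr y).

Lemma frac_leP (a b : frac_unit) :
  reflect (exists r : R, val b = (val a * r%:F)%R) (frac_le a b).
Proof.
apply: (iffP (asboolP _)) => [ab|[r bE] _ [s ->]].
  by apply: (ab (val b)); exists 1%R; rewrite rmorph1 mulr1.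
by exists (r * s)%R; rewrite bE rmorphM mulrA.
Qed.

Lemma frac_le_refl : reflexive frac_le.
Proof. by move=> a; apply/asboolP. Qed.

Lemma frac_le_trans : transitive frac_le.
Proof.
by move=> b a c /asboolP ab /asboolP bc; apply/asboolP => x /bc /ab.
Qed.

Lemma frac_le_eq (a b : frac_unit) :
  gamma_eq a b = frac_le a b && frac_le b a.
Proof.
apply/idP/andP => [ab|[/frac_leP[r bE] /frac_leP[s aE]]].
  split; apply/frac_leP; first by have /asboolP[u _] := ab; exists u.
  by move: ab; rewrite gamma_eq_sym => /asboolP[u _]; exists u.
apply/asboolP; exists r => //; apply/unitrPr; exists s.
apply/eqP; rewrite -tofrac_eq rmorphM rmorph1 -(inj_eq (mulfI (valP a))).
by rewrite mulrA -bE -aE mulr1.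
Qed.

Lemma gamma_le_pi (a b : frac_unit) :
  gamma_le (\pi_Gamma a) (\pi_Gamma b) = frac_le a b.
Proof.
have rE c : gamma_eq (repr (\pi_Gamma c)) c.
  by rewrite -[gamma_eq _ _]/(equiv gamma_equiv _ _) -eqmodE reprK.
have := rE a; have := rE b; rewrite !frac_le_eq.
move=> /andP[b1 b2] /andP[a1 a2]; apply/idP/idP => ab.
  exact: frac_le_trans a2 (frac_le_trans ab b1).
exact: frac_le_trans a1 (frac_le_trans ab b2).
Qed.

Fact gamma_le_refl : reflexive gamma_le.
Proof. by move=> x; apply: frac_le_refl. Qed.

Fact gamma_le_anti : antisymmetric gamma_le.
Proof.
elim/quotW=> a; elim/quotW=> b; rewrite !gamma_le_pi -frac_le_eq => ab.
exact/eqmodP.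
Qed.

Fact gamma_le_trans : transitive gamma_le.
Proof. by move=> y x z; apply: frac_le_trans. Qed.

HB.instance Definition _ := Order.Le_isPOrder.Build (Order.Disp tt tt) Gamma
  gamma_le_refl gamma_le_anti gamma_le_trans.

(* The class of [1], that is, the neutral element of the value group. *)
Definition gamma1 : Gamma := \pi_Gamma (exist (fun a => a != 0%R) 1%R (oner_neq0 _)).

End ValueGroup.

Fact frac_glb_subproof1 (F : fieldType) (p p' q q' x y : F) :
  q != 0%R -> q' != 0%R ->
  ((x * (p * q') + y * (p' * q)) / (q * q') = p / q * x + p' / q' * y)%R.
Proof. by move=> q0 q'0; field; rewrite q0 q'0. Qed.

Fact frac_glb_subproof2 (F : fieldType) (p q q' g r : F) :
  q != 0%R -> q' != 0%R -> (p * q' = g * r)%R -> (p / q = g / (q * q') * r)%R.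
Proof.
move=> q0 q'0 E; rewrite mulrAC -E; field; exact/andP.
Qed.

Fact frac_inv_subproof (F : fieldType) (a b r : F) :
  a != 0%R -> b != 0%R -> (b = a * r)%R -> (a^-1 = b^-1 * r)%R.
Proof.
move=> a0 b0 bE; apply: (mulIf a0); rewrite mulVf // -mulrA (mulrC r) -bE.
by rewrite mulVf.
Qed.

Section ValueGroupLattice.
Variable R : bezoutDomainType.
Implicit Types a b c : frac_unit R.

Lemma fractionP (x : {fraction R}) :
  exists p q : R, q != 0%R /\ x = (p%:F / q%:F)%R.
Proof.
elim/quotW: x => x; exists \n_x, \d_x; split; first exact: denom_ratioP.
have d0 : (\d_x)%:F != 0%R :> {fraction R} by rewrite tofrac_eq0 denom_ratioP.
apply: (mulIf d0); rewrite divfK //; unlock FracField.tofrac.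
rewrite -[LHS]FracField.pi_mul; apply/eqmodP.
rewrite -[equiv _ _ _]/(FracField.equivf _ _) /FracField.equivf /FracField.mulf.
by rewrite !numden_Ratio ?mulr1 ?oner_neq0 ?denom_ratioP 1?mulrC.
Qed.

Lemma bezout_gcd (p q : R) :
  exists g, (exists x y : R, g = (x * p + y * q)%R) /\
    (exists r s : R, p = (r * g)%R /\ q = (s * g)%R).
Proof.
have [g gP] := fg_ideal_principal [:: p; q]; exists g; split.
  have /gP[c ->] : principal_ideal g g by exists 1%R; rewrite mul1r.
  by exists (c ord0), (c ord_max); rewrite !big_ord_recl big_ord0 addr0 /=;
    congr (_ + c _ * _)%R; apply: val_inj.
have /gP[r pE] : fg_ideal [:: p; q] p.
  exists (fun i => (nat_of_ord i == 0)%:R%R).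
  by rewrite !big_ord_recl big_ord0 /= mul1r mul0r !addr0.
have /gP[s qE] : fg_ideal [:: p; q] q.
  exists (fun i => (nat_of_ord i == 1)%:R%R).
  by rewrite !big_ord_recl big_ord0 /= mul1r mul0r addr0 add0r.
by exists r, s.
Qed.

Lemma frac_glb a b :
  exists c, forall t, frac_le t c = frac_le t a && frac_le t b.
Proof.
case: a b => [a a0] [b b0].
have [p [q [q0 aE]]] := fractionP a; have [p' [q' [q'0 bE]]] := fractionP b.
have qF : q%:F != 0%R :> {fraction R} by rewrite tofrac_eq0.
have q'F : q'%:F != 0%R :> {fraction R} by rewrite tofrac_eq0.
have [g [[x [y gE]] [r [s [pE p'E]]]]] := bezout_gcd (p * q') (p' * q).
pose c := (g%:F / (q * q')%:F)%R.
have cE : c = (a * x%:F + b * y%:F)%R.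
  by rewrite /c gE aE bE !rmorphD !rmorphM /=; exact: frac_glb_subproof1.
have aE' : a = (c * r%:F)%R.
  by rewrite /c aE; rewrite rmorphM /=; apply: frac_glb_subproof2; rewrite // -!rmorphM pE mulrC.
have bE' : b = (c * s%:F)%R.
  rewrite /c bE [in RHS](mulrC q).
  by rewrite rmorphM /=; apply: frac_glb_subproof2; rewrite // -!rmorphM p'E mulrC.
have c0 : c != 0%R by apply: contraNneq a0 => c0; rewrite aE' c0 mul0r.
exists (exist _ c c0) => t; apply/frac_leP/andP => /= [[u cu]|[]].
  split; apply/frac_leP => /=.
    by exists (u * r)%R; rewrite aE' cu rmorphM mulrA.
  by exists (u * s)%R; rewrite bE' cu rmorphM mulrA.
move=> /frac_leP[u /= au] /frac_leP[v /= bv].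
by exists (u * x + v * y)%R; rewrite cE au bv rmorphD !rmorphM mulrDr !mulrA.
Qed.

Definition frac_inv a : frac_unit R :=
  exist (fun x => x != 0%R) (val a)^-1%R (invr_neq0 (valP a)).

Lemma frac_invK : involutive frac_inv.
Proof. by move=> a; apply: val_inj; rewrite /= invrK. Qed.

Lemma frac_le_inv a b : frac_le (frac_inv a) (frac_inv b) = frac_le b a.
Proof.
have le_inv c e : frac_le c e -> frac_le (frac_inv e) (frac_inv c).
  move=> /frac_leP[r eE]; apply/frac_leP; exists r.
  exact: frac_inv_subproof (valP c) (valP e) eE.
by apply/idP/idP => [/le_inv|/le_inv //]; rewrite !frac_invK.
Qed.

Lemma frac_lub a b :
  exists c, forall t, frac_le c t = frac_le a t && frac_le b t.
Proof.
have [c cP] := frac_glb (frac_inv a) (frac_inv b); exists (frac_inv c) => t.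
by rewrite -{1}[t]frac_invK frac_le_inv cP !frac_le_inv.
Qed.

Definition gamma_meet (x y : Gamma R) : Gamma R :=
  \pi_(Gamma R) (sval (cid (frac_glb (repr x) (repr y)))).
Definition gamma_join (x y : Gamma R) : Gamma R :=
  \pi_(Gamma R) (sval (cid (frac_lub (repr x) (repr y)))).

Fact gamma_meetP (x y z : Gamma R) :
  (x <= gamma_meet y z) = (x <= y) && (x <= z).
Proof.
rewrite -{1}[x]reprK [LHS]gamma_le_pi /gamma_meet.
by case: cid => c /= ->.
Qed.

Fact gamma_joinP (x y z : Gamma R) :
  (gamma_join x y <= z) = (x <= z) && (y <= z).
Proof.
rewrite -{1}[z]reprK [LHS]gamma_le_pi /gamma_join.
by case: cid => c /= ->.
Qed.

HB.instance Definition _ := Order.POrder_MeetJoin_isLattice.Build _ (Gamma R)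
  gamma_meetP gamma_joinP.

Definition gamma_pos := {x : Gamma R | gamma1 R <= x}.

HB.instance Definition _ := SubChoice.on gamma_pos.

Fact gamma_pos_meet : meet_closed (fun x : Gamma R => gamma1 R <= x).
Proof. move=> x y x0 y0; rewrite -topredE /= lexI; exact/andP. Qed.

Fact gamma_pos_join : join_closed (fun x : Gamma R => gamma1 R <= x).
Proof. by move=> x y x0 _; apply: (le_trans x0 (leUl _ _)). Qed.

HB.instance Definition _ :=
  Order.SubChoice_isSubLattice.Build _ (Gamma R) _ (Order.Disp tt tt) gamma_pos
    gamma_pos_meet gamma_pos_join.

Definition gamma_pos1 : gamma_pos := Sub (gamma1 R) (lexx _).

Fact gamma_pos_le1x (x : gamma_pos) : gamma_pos1 <= x.
Proof. exact: (valP x). Qed.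

HB.instance Definition _ :=
  Order.hasBottom.Build _ gamma_pos gamma_pos_le1x.

Definition gamma_pos_inf := topped gamma_pos.

End ValueGroupLattice.

Section MdimZero.
Context {d : Order.disp_t} {T : bLatticeType d}.
Implicit Types x y : topped T.
Definition is_top x := if x is Topmost then true else false.

Lemma top_not_msim (K : congruence (topped T)) :
  (forall x y, K x y <-> x = y) ->
  (forall a : T, exists b, a < b) ->
  ~ msim (cquot K) (\pi \bot) (\pi \top).
Proof.
move=> Keq up /asboolP.
have rE x : repr (\pi_(cquot K) x) = x.
  by symmetry; apply/Keq/cong_repr.
pose e : rel (cquot K) := fun u v => is_top (repr u) == is_top (repr v).
have eP : equiv_class_of e.
  by split=> [x|x y|y x z]; rewrite /e // ?[_ == is_top (repr x)]eq_sym // => /eqP ->.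
have rI (u v : cquot K) : repr (u `&` v) = repr u `&` repr v by rewrite [LHS]rE.
have rU (u v : cquot K) : repr (u `|` v) = repr u `|` repr v by rewrite [LHS]rE.
have tI x y : is_top (x `&` y) = is_top x && is_top y by case: x y => [?|] [?|].
have tU x y : is_top (x `|` y) = is_top x || is_top y by case: x y => [?|] [?|].
have eI u u' v v' : e u u' -> e v v' -> e (u `&` v) (u' `&` v').
  by rewrite /e !rI !tI => /eqP -> /eqP ->.
have eU u u' v v' : e u u' -> e v v' -> e (u `|` v) (u' `|` v').
  by rewrite /e !rU !tU => /eqP -> /eqP ->.
move=> /(_ (Congruence eP eI eU)) /= h.
suff : e (\pi \bot) (\pi \top) by rewrite /e !rE.
apply: h => u v [uv [c [f cf]]].
have pile x y : x <= y -> (\pi_(cquot K) x <= \pi_(cquot K) y).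
  by move=> /meet_idPl xy; rewrite leEmeet -[_ `&` _]pi_cquotI xy.
have leR (x y : cquot K) : x <= y -> repr x <= repr y.
  by rewrite leEmeet => /eqP E; rewrite leEmeet -rI E.
move: uv cf; rewrite -[u]reprK -[v]reprK /e !rE.
case: (repr u) (repr v) => [a|] [b|] //= uv cf; last first.
  by have := leR _ _ uv; rewrite !rE.
exfalso; have [a' aa'] := up a.
have pinj x y : \pi_(cquot K) x = \pi_(cquot K) y -> x = y.
  by move=> E; rewrite -[x]rE E rE.
have i x : Below a <= x -> \pi_(cquot K) x \in `[\pi_(cquot K) (Below a), \pi_(cquot K) Topmost].
  by move=> ax; rewrite in_itv /=; apply/andP; split; apply: pile => //; apply: lex1.
have i1 := cf _ (i _ (lexx _)).
have i2 := cf _ (i (Below a') (ltW aa')).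
have i3 := cf _ (i Topmost (lex1 _)).
have aa'N : a <> a' by move=> E; move: aa'; rewrite E ltxx.
have n12 : ~ \pi_(cquot K) (Below a) = \pi_(cquot K) (Below a') by move=> /pinj[].
have n13 : ~ \pi_(cquot K) (Below a) = \pi_(cquot K) Topmost by move=> /pinj.
have n23 : ~ \pi_(cquot K) (Below a') = \pi_(cquot K) Topmost by move=> /pinj.
case: i1 i2 i3 => E1 [] E2 [] E3; first [by apply: n12; rewrite E1 E2
 | by apply: n13; rewrite E1 E3 | by apply: n23; rewrite E2 E3].
Qed.

Lemma mdim0_topped d' (W : orderType d') : (W -> False) ->
  (forall a : T, exists b, a < b) ->
  ~ has_mdim (topped T) W.
Proof.
move=> W0 up [_ [K [[K0 KS _] [p pP] _]]].
have z : is_zero (Below Topmost : topped (topped W)) by move=> [[w|]|].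
have s : is_succ (Below Topmost : topped (topped W)) \top.
  by split=> // -[[w|]|].
apply: (top_not_msim (K0 _ z) up).
apply/(KS _ _ s)/eqmodP.
by rewrite (pP (\pi \bot)) (pP (\pi \top)).
Qed.
End MdimZero.

Lemma gamma_pos_up (R : bezoutDomainType) : has_krull_dim R 1 ->
  forall a : gamma_pos R, exists b, a < b.
Proof.
move=> [[P [Ppr /(_ 0 isT)[_ [r r1 r0]]]] _].
have [[_ P1 PI] _] := Ppr 1 isT; have [[P00 _ _] _] := Ppr 0 isT.
have rn : r != 0%R by apply: contraNneq r0 => ->.
have ru : r \isn't a GRing.unit.
  apply/negP=> ur; move: P1; rewrite -(mulVr ur) -[(_ * r)%R]addr0.
  have h0 : (0%R : R) \in P 1 by have [[]] := Ppr 1 isT.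
  by rewrite PI.
move=> [a a1].
have an : (val (repr a) * r%:F)%R != 0%R.
  by rewrite mulf_neq0 ?tofrac_eq0 ?(valP (repr a)).
pose c : frac_unit R := exist (fun x => x != 0%R) _ an.
have ac : a < \pi_(Gamma R) c.
  rewrite lt_leAnge -{1 2}[a]reprK; apply/andP; split.
    rewrite [_ <= _]gamma_le_pi; apply/frac_leP; exists r; reflexivity.
  rewrite [_ <= _]gamma_le_pi; apply/frac_leP => -[s /= E].
  case/negP: ru; apply/unitrPr; exists s; apply/eqP.
  rewrite -tofrac_eq rmorph1 rmorphM -(inj_eq (mulfI (valP (repr a)))) mulrA.
  by rewrite -[X in X == _]E mulr1.
have c1 : gamma1 R <= \pi_(Gamma R) c by apply: le_trans a1 (ltW ac).
exists (exist (fun x : Gamma R => gamma1 R <= x) _ c1); exact: ac.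
Qed.

(* If [R] has Krull dimension 1 then the value group is nontrivial, so no
   two-element interval has endpoint [Topmost], which therefore is not
   identified with any finite value in one step: the m-dimension is not 0. *)
Proposition krull_dim1_mdim_neq0 (R : bezoutDomainType) (d : Order.disp_t)
    (W : orderType d) :
  (W -> False) -> has_krull_dim R 1 -> ~ has_mdim (gamma_pos_inf R) W.
Proof. by move=> W0 /gamma_pos_up; apply: mdim0_topped. Qed.

(* Main.v *)
Require Import Defs.
From HB Require Import structures.
From mathcomp Require Import all_boot all_order all_algebra.
From mathcomp Require Import boolp wochoice finmap monalg ring zify.

Set Implicit Arguments.
Unset Strict Implicit.
Unset Printing Implicit Defensive.

Import Order.TTheory GRing.Theory Num.Theory.

(** By Krull, Kaplansky, Jaffard and Ohm, every lattice ordered abelian group is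
    the value group of a Bezout domain, so the statement is about groups.  Take
    a scattered, locally compact, totally disconnected space [X] and the group
    of its continuous integer valued functions with compact support.  This group
    is hyperarchimedean, which on the side of the ring means Krull dimension 1.
    Collapsing the small intervals of the lattice of nonnegative functions with
    a top added identifies two functions when they differ only at isolated
    points, that is, it restricts functions to the Cantor-Bendixson derivative of
    [X]; the top stays alone as long as the derivative is not empty.  Once the
    derivative is empty the lattice has two points, and one more step leaves one
    point.  Hence the m-dimension is the Cantor-Bendixson rank of [X], and any
    nonzero ordinal is the rank of some [X].

    The space used here is a forest.  Its points are the nonempty finite
    decreasing sequences of elements of [W] tagged by natural numbers ([node]),
    the last element being the rank of the point, and its compact open sets are
    generated by the cones.  A point of rank [w] has infinitely many children of
    each rank below [w], so the rank is the Cantor-Bendixson rank.  A function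
    is continuous with compact support exactly when it differs from its value at
    the parent at finitely many points only ([finite_jumps]); this finiteness
    replaces compactness in every argument.
    [forest_has_mdim] computes the m-dimension of any lattice of such functions;
    the kernel at stage [w] is agreement on the points of rank at least [w].

    The ring is a Kronecker function ring.  The nonnegative functions form a
    monoid; on its integral monoid algebra, the valuation at a point [x] of a
    nonzero element is the least value at [x] of a function in the support.
    These valuations are multiplicative ([contentM]) because the monoid has total
    orders compatible with addition that refine the comparison of values at [x].
    The ring [kronecker] consists of the fractions whose numerator has, at every
    point, at least the valuation of the denominator.  It is Bezout because for
    nonzero [p] and [q] a large [n] prevents all cancellation in [p + q *+ n],
    which thus generates the ideal of [p] and [q] ([content_min],
    [kronecker_bezout]).  Divisibility in it is the pointwise comparison of
    valuations, so the positive cone of its value group is the lattice of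
    functions above ([pos_value_le], [pos_value_onto]), and the boundedness of
    those functions gives [valued_krull_dim1]. *)

Local Open Scope order_scope.
Local Open Scope quotient_scope.

(** * A forest of prescribed ranks *)

Section Nodes.
Context {d : Order.disp_t} (W : orderType d).

(** A sequence is stored from its last element backwards, so that removing the
    head gives the parent and the head carries the rank.  The head is kept apart
    from the tail because the empty sequence is not a point. *)
Definition node :=
  {s : (W * nat) * seq (W * nat) | path (fun a b => a.1 < b.1) s.1 s.2}.

HB.instance Definition _ := Choice.on node.

Definition rank (x : node) : W := (val x).1.1.

Definition parent (x : node) : option node :=
  if (val x).2 is a :: s then insub (a, s) else None.

(** The descendants of [y], including [y] itself: a compact open set. *)
Definition in_cone (y x : node) : bool :=
  suffix ((val y).1 :: (val y).2) ((val x).1 :: (val x).2).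

Lemma parent_spec (x y : node) : parent x = Some y ->
  (val x).2 = (val y).1 :: (val y).2.
Proof.
rewrite /parent; case: (val x).2 => [//|a s].
by case: insubP => //= u _ uE [<-]; rewrite uE.
Qed.

Lemma parent_none (x : node) : parent x = None -> (val x).2 = [::].
Proof.
rewrite /parent; case: x => -[a [//|b s]] /= p.
by case: insubP => //= /negP[]; case/andP: p.
Qed.

Lemma rank_parent (x y : node) : parent x = Some y -> rank x < rank y.
Proof.
move=> /parent_spec xy; have := valP x; rewrite /= xy /= => /andP[xy1 _].
exact: xy1.
Qed.

(** Ranks increase along parents, so the induction is on the depth instead. *)
Lemma node_ind (P : node -> Prop) :
  (forall x, (forall y, parent x = Some y -> P y) -> P x) -> forall x, P x.
Proof.
move=> IH x; have [n] := ubnP (size (val x).2); elim: n x => // n IHn x xn.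
apply: IH => y /parent_spec xy; apply: IHn.
by move: xn; rewrite xy.
Qed.

Lemma in_coneE (y x : node) :
  in_cone y x = (x == y) || oapp (in_cone y) false (parent x).
Proof.
have val2E (u v : node) :
    (u == v) = ((val u).1 :: (val u).2 == (val v).1 :: (val v).2).
  rewrite -val_eqE eqseq_cons; case: (val u) (val v) => [a s] [b t] /=.
  by rewrite xpair_eqE.
rewrite /in_cone val2E.
have sc (a : W * nat) (s t : seq (W * nat)) :
  suffix s (a :: t) = (s == a :: t) || suffix s t.
  rewrite /suffix rev_cons; apply/prefixP/orP => [[u]|[/eqP->|/prefixP[u E]]].
  - case/lastP: u => [|u b]; rewrite ?cats0 -?rcons_cat.
      by move=> /esym E; left; apply/eqP/(can_inj revK); rewrite rev_cons.
    by move=> /rcons_inj[E _]; right; apply/prefixP; exists u.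
  - by exists [::]; rewrite cats0 rev_cons.
  - by exists (rcons u a); rewrite E rcons_cat.
rewrite sc eq_sym; congr (_ || _).
case px: (parent x) => [z|] /=; first by rewrite (parent_spec px).
by rewrite (parent_none px) suffixs0.
Qed.

Lemma rank_cone (y x : node) : in_cone y x -> rank x <= rank y.
Proof.
elim/node_ind: x => x IH; rewrite in_coneE => /orP[/eqP -> //|].
case px: (parent x) => [z|] //= yz.
exact: le_trans (ltW (rank_parent px)) (IH z px yz).
Qed.

(** The tags make the children of each admissible rank infinitely many: no point
    of rank above [v] is isolated among the points of rank at least [v].  With
    [None] for the parent one gets the roots, of every rank. *)
Lemma exists_child (p : option node) (v : W) (s : seq node) :
  (forall x, p = Some x -> v < rank x) ->
  exists y, [/\ parent y = p, rank y = v & y \notin s].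
Proof.
move=> vp; set t := if p is Some x then (val x).1 :: (val x).2 else [::].
have tP n : path (fun a b : W * nat => a.1 < b.1) (v, n) t.
  rewrite /t; case: (p) vp => [x|//] vx /=.
  by have := valP x => /= ->; rewrite (vx x).
pose y n : node := exist (fun s => path _ s.1 s.2) ((v, n), t) (tP n).
have [n ns] : exists n, y n \notin s.
  have [n nP] : exists n, forall z, z \in s -> ((val z).1.2 < n)%N.
    elim: (s) => [|z r [n nP]]; first by exists 0.
    exists (maxn n (val z).1.2.+1) => u; rewrite inE => /orP[/eqP->|/nP un].
      by rewrite leq_max leqnn orbT.
    by rewrite leq_max un.
  by exists n; apply/negP => /nP; rewrite /= ltnn.
exists (y n); split=> //; rewrite /parent /= /t.
by case: (p) => [x|//]; rewrite -surjective_pairing valK.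
Qed.

(** Functions are extended by 0 above the roots: this is what makes the support
    of a function with finitely many jumps compact. *)
Definition parent_value (f : node -> nat) (x : node) : nat :=
  oapp f 0%N (parent x).

Definition finite_jumps (f : node -> nat) :=
  exists s : seq node, forall x, f x <> parent_value f x -> x \in s.

Lemma finite_jumps0 : finite_jumps (fun=> 0%N).
Proof. by exists [::] => x; rewrite /parent_value; case: (parent x). Qed.

Lemma finite_jumps_op (op : nat -> nat -> nat) f g : op 0%N 0%N = 0%N ->
  finite_jumps f -> finite_jumps g -> finite_jumps (fun x => op (f x) (g x)).
Proof.
move=> op0 [s sP] [t tP]; exists (s ++ t) => x ne; rewrite mem_cat.
apply/orP; apply: contrapT => /not_orP[xs xt]; apply: ne.
have -> : f x = parent_value f x by apply: contrapT => /sP.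
have -> : g x = parent_value g x by apply: contrapT => /tP.
by rewrite /parent_value; case: (parent x).
Qed.

Lemma finite_jumps_override f y n : finite_jumps f ->
  finite_jumps (fun x => if in_cone y x then n else f x).
Proof.
move=> [s sP]; exists (y :: s) => x ne; rewrite inE.
apply/orP; apply: contrapT => /not_orP[/negP/negbTE xy xs]; apply: ne.
have fE : f x = parent_value f x by apply: contrapT => /sP.
rewrite in_coneE xy fE /parent_value /=.
by case: (parent x).
Qed.

Lemma finite_jumps_cone y : finite_jumps (in_cone y).
Proof.
apply: eq_ind (finite_jumps_override y 1 finite_jumps0) _ _.
by apply: funext => x; case: in_cone.
Qed.

(** Off the jumps, a value is inherited from the parent, so every nonzero value
    is attained at a jump. *)
Lemma finite_jumps_bounded f : finite_jumps f ->
  exists n, forall x, (f x <= n)%N.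
Proof.
move=> [s sP]; exists (\max_(x <- s) f x)%N; elim/node_ind => x IH.
have [xs|xs] := boolP (x \in s); first exact: leq_bigmax_seq.
have -> : f x = parent_value f x by apply: contrapT => /sP; rewrite (negbTE xs).
rewrite /parent_value; case px: (parent x) => [y|//] /=; exact: IH.
Qed.

End Nodes.

(** * Small intervals in quotient lattices *)

Section CongruenceQuotient.
Context {d : Order.disp_t} {L : latticeType d} (K : congruence L).
Implicit Types (a b c : L) (J : congruence L).

Lemma cong_refl a : K a a.
Proof. exact: (equiv_refl (cong_equiv_rel K)). Qed.

Lemma cong_sym a b : K a b -> K b a.
Proof. by rewrite (equiv_sym (cong_equiv_rel K) a b). Qed.

Lemma cong_trans b a c : K a b -> K b c -> K a c.
Proof. exact: (equiv_trans (e := cong_equiv_rel K)). Qed.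

Lemma pi_cquotP a b : (\pi_(cquot K) a = \pi_(cquot K) b) <-> K a b.
Proof. by split=> [/eqmodP //|ab]; apply/eqmodP. Qed.

Lemma pi_cquot_le a b : a <= b -> (\pi_(cquot K) a <= \pi_(cquot K) b).
Proof. by move=> /meet_idPl ab; rewrite leEmeet -[_ `&` _]pi_cquotI ab. Qed.

Lemma cquot_le_lift (u v : cquot K) : u <= v ->
  exists a b, [/\ a <= b, \pi_(cquot K) a = u & \pi_(cquot K) b = v].
Proof.
move=> /join_idPr uv; exists (repr u), (repr u `|` repr v).
by split; [exact: leUl|exact: reprK|rewrite pi_cquotU !reprK].
Qed.

(** Every class between those of [a] and [b] has a representative between [a]
    and [b], so small intervals of the quotient can be tested upstairs. *)
Lemma small_interval_pi a b : a <= b ->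
  (forall c, a <= c -> c <= b -> K c a \/ K c b) ->
  small_interval (\pi_(cquot K) a) (\pi_(cquot K) b).
Proof.
move=> ab abP; split; first exact: pi_cquot_le.
exists (\pi_(cquot K) a), (\pi_(cquot K) b); elim/quotW=> c.
rewrite in_itv /= => /andP[ac cb].
have -> : \pi_(cquot K) c = \pi_(cquot K) ((c `|` a) `&` b).
  have -> : \pi_(cquot K) ((c `|` a) `&` b)
      = ((\pi_(cquot K) c `|` \pi_(cquot K) a) `&` \pi_(cquot K) b).
    by rewrite pi_cquotI pi_cquotU.
  by rewrite (join_idPl ac) (meet_idPl cb).
have [] := abP ((c `|` a) `&` b).
- by rewrite lexI leUr.
- by rewrite leIr.
- by left; apply/pi_cquotP.
- by right; apply/pi_cquotP.
Qed.

Lemma not_small_interval_pi a c b : a <= c -> c <= b ->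
  ~ K a c -> ~ K c b -> ~ small_interval (\pi_(cquot K) a) (\pi_(cquot K) b).
Proof.
move=> ac cb Nac Ncb [_ [u [v uvP]]].
have Nab : ~ K a b.
  move=> ab; apply: Nac.
  have := congI ab (cong_refl c).
  by rewrite (meet_idPl ac) (meet_idPr cb).
have h e : a <= e -> e <= b -> \pi_(cquot K) e = u \/ \pi_(cquot K) e = v.
  by move=> ae eb; apply: uvP; rewrite in_itv /= !pi_cquot_le.
have [] := h a (lexx _) (le_trans ac cb); have [] := h c ac cb;
  have [] := h b (le_trans ac cb) (lexx _) => Eb Ec Ea;
  by [case: Nac; apply/pi_cquotP; rewrite Ea Ec
     |case: Ncb; apply/pi_cquotP; rewrite Ec Eb
     |case: Nab; apply/pi_cquotP; rewrite Ea Eb].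
Qed.

Lemma msim_small (u v : cquot K) : small_interval u v -> msim (cquot K) u v.
Proof. by move=> uv; apply/asboolP => K'; apply. Qed.

(** The induction principle for one step of the m-dimension sequence: a
    congruence of the lattice that contains the kernel [K] and collapses the
    intervals that become small modulo [K] contains the kernel of the next
    stage. *)
Lemma msim_min J : (forall a b, K a b -> J a b) ->
  (forall a b, a <= b ->
    small_interval (\pi_(cquot K) a) (\pi_(cquot K) b) -> J a b) ->
  forall a b, msim (cquot K) (\pi a) (\pi b) -> J a b.
Proof.
move=> KJ smallJ.
have Jr := equiv_refl (cong_equiv_rel J).
have Jt := equiv_trans (e := cong_equiv_rel J).
have Js := equiv_sym (cong_equiv_rel J).
have reprJ a : J a (repr (\pi_(cquot K) a)) by apply: KJ; exact: cong_repr.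
pose e : rel (cquot K) := fun u v => J (repr u) (repr v).
have eP : equiv_class_of e.
  split=> [u|u v|v u w]; [exact: Jr|exact: Js|exact: Jt].
have eI u u' v v' : e u u' -> e v v' -> e (u `&` v) (u' `&` v').
  move=> uu' vv'; rewrite /e.
  apply: Jt (Jt _ _ _ _ (congI uu' vv')) (reprJ _).
  by rewrite Js; apply: reprJ.
have eU u u' v v' : e u u' -> e v v' -> e (u `|` v) (u' `|` v').
  move=> uu' vv'; rewrite /e.
  apply: Jt (Jt _ _ _ _ (congU uu' vv')) (reprJ _).
  by rewrite Js; apply: reprJ.
move=> a b /asboolP/(_ (Congruence eP eI eU)) /= eab.
suff ab : e (\pi a) (\pi b).
  by apply: Jt (Jt _ _ _ (reprJ a) ab) _; rewrite Js; apply: reprJ.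
apply: eab => u v [uv uvP].
have [a' [b' [ab' aE bE]]] := cquot_le_lift uv.
have a'b' : J a' b' by apply: smallJ => //; rewrite aE bE.
rewrite /e -aE -bE; apply: Jt (Jt _ _ _ _ a'b') (reprJ _).
by rewrite Js; apply: reprJ.
Qed.

End CongruenceQuotient.

(** * The m-dimension of the lattice of functions on the forest *)

Section ForestLattice.
Context {d : Order.disp_t} (W : orderType d).
Context {d' : Order.disp_t} {T : bLatticeType d'} (ev : T -> node W -> nat).
Context (ev_le : forall a b, a <= b <-> forall x, (ev a x <= ev b x)%N).
Context (ev_fin : forall a, finite_jumps (ev a)).
Context (ev_onto : forall f, finite_jumps f -> exists a, ev a = f).

Lemma ev_inj a b : ev a = ev b -> a = b.
Proof.
by move=> E; apply/le_anti/andP; split; apply/ev_le => x; rewrite E.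
Qed.

(** Only the order of [T] is described by [ev]; meets and joins follow since the
    pointwise minimum and maximum are again values of [ev]. *)
Lemma evI a b x : ev (a `&` b) x = minn (ev a x) (ev b x).
Proof.
have [c cE] := ev_onto (finite_jumps_op (op := minn) erefl (ev_fin a) (ev_fin b)).
suff -> : a `&` b = c by rewrite cE.
apply/le_anti; rewrite lexI; apply/and3P; split; apply/ev_le => y; rewrite cE.
- rewrite leq_min; apply/andP; split; move: y; apply/ev_le; first exact: leIl.
  exact: leIr.
- exact: geq_minl.
- exact: geq_minr.
Qed.

Lemma evU a b x : ev (a `|` b) x = maxn (ev a x) (ev b x).
Proof.
have [c cE] := ev_onto (finite_jumps_op (op := maxn) erefl (ev_fin a) (ev_fin b)).
suff -> : a `|` b = c by rewrite cE.
apply/le_anti; rewrite leUx; apply/andP; split; last first.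
  apply/ev_le => y; rewrite cE.
  rewrite geq_max; apply/andP; split; move: y; apply/ev_le; first exact: leUl.
  exact: leUr.
apply/andP; split; apply/ev_le => y; rewrite cE.
- exact: leq_maxl.
- exact: leq_maxr.
Qed.

Local Notation ord := (topped (topped W)).

(** Ranks seen among the ordinals at most one above the order type of [W].  No
    point has rank [Below Topmost], where the derivative is thus empty. *)
Definition ord_rank (x : node W) : ord := Below (Below (rank x)).

Lemma ord_rank_lt_top x : ord_rank x < Below Topmost.
Proof. by []. Qed.

Definition agree (w : ord) (a b : T) := forall x, w <= ord_rank x -> ev a x = ev b x.

(** The kernel of stage [w].  The added top is identified with the functions at
    the very last stage only. *)
Definition forest_rel (w : ord) : rel (topped T) := fun f g =>
  match f, g with
  | Below a, Below b => `[< agree w a b >]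
  | Topmost, Topmost => true
  | _, _ => w == \top
  end.

Fact agree_top w a b : w == \top -> agree w a b.
Proof. by move=> /eqP -> x. Qed.

Fact forest_rel_equiv w : equiv_class_of (forest_rel w).
Proof.
split=> [[a|]|[a|] [b|]|[b|] [a|] [c|]] //=.
- by apply/asboolP.
- by apply/asboolP/asboolP => ab x wx; rewrite ab.
- move=> /asboolP ab /asboolP bc; apply/asboolP => x wx.
  by rewrite ab ?bc.
- by move=> wT _; apply/asboolP; apply: agree_top.
Qed.

Fact forest_relI w f f' g g' : forest_rel w f f' -> forest_rel w g g' ->
  forest_rel w (f `&` g) (f' `&` g').
Proof.
have aI a a' b b' : agree w a a' -> agree w b b' -> agree w (a `&` b) (a' `&` b').
  by move=> aa' bb' x wx; rewrite !evI aa' ?bb'.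
case: f f' g g' => [a|] [a'|] [b|] [b'|] //=;
  try by [|move=> wT _; apply/asboolP; apply: agree_top
          |move=> _ wT; apply/asboolP; apply: agree_top].
by move=> /asboolP aa' /asboolP bb'; apply/asboolP; apply: aI.
Qed.

Fact forest_relU w f f' g g' : forest_rel w f f' -> forest_rel w g g' ->
  forest_rel w (f `|` g) (f' `|` g').
Proof.
have aU a a' b b' : agree w a a' -> agree w b b' -> agree w (a `|` b) (a' `|` b').
  by move=> aa' bb' x wx; rewrite !evU aa' ?bb'.
case: f f' g g' => [a|] [a'|] [b|] [b'|] //=.
by move=> /asboolP aa' /asboolP bb'; apply/asboolP; apply: aU.
Qed.

Definition forest_cong w : congruence (topped T) :=
  Congruence (forest_rel_equiv w) (@forest_relI w) (@forest_relU w).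

Local Notation K := forest_cong.
Local Notation pK w := (\pi_(cquot (forest_cong w))).

Lemma forest_cong_mono v w f g : v <= w -> K v f g -> K w f g.
Proof.
move=> vw; case: f g => [a|] [b|] //=; last 2 first.
- by move=> /eqP vT; move: vw; rewrite vT le1x.
- by move=> /eqP vT; move: vw; rewrite vT le1x.
by move=> /asboolP ab; apply/asboolP => x wx; apply: ab; apply: le_trans wx.
Qed.

(** Functions that differ by 1 at a single point of rank [v], among the points
    of rank at least [v], are the endpoints of an interval with two elements at
    stage [v]. *)
Lemma msim_step v a b x : ord_rank x = v ->
  (forall y, v <= ord_rank y -> y <> x -> ev a y = ev b y) ->
  ev b x = (ev a x).+1 -> a <= b ->
  msim (cquot (K v)) (pK v (Below a)) (pK v (Below b)).
Proof.
move=> xv abP bx ab; apply: msim_small; apply: small_interval_pi => //.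
case=> [c|] //= /ev_le ac /ev_le cb.
have cE y : v <= ord_rank y -> y <> x -> ev c y = ev a y.
  move=> vy yx; apply/anti_leq; rewrite ac andbT.
  by rewrite (abP y vy yx) cb.
have : (ev c x == ev a x) || (ev c x == ev b x).
  by have := ac x; have := cb x; rewrite bx; lia.
case/orP => /eqP cx; [left|right]; apply/asboolP => y vy;
  have [-> //|/eqP yx] := eqVneq y x; rewrite cE //; exact: abP.
Qed.

Lemma ord_rank_lt (x y : node W) : (ord_rank x < ord_rank y) = (rank x < rank y).
Proof. by rewrite !ltNge. Qed.

Local Notation "f ~[ v ] g" := (msim (cquot (forest_cong v)) (pK v f) (pK v g))
  (at level 70).

Lemma msim_cong v f g : K v f g -> f ~[v] g.
Proof. by move=> /pi_cquotP ->; apply: cong_refl. Qed.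

Lemma msim_trans v g f h : f ~[v] g -> g ~[v] h -> f ~[v] h.
Proof. exact: cong_trans. Qed.

Lemma msim_sym v f g : f ~[v] g -> g ~[v] f.
Proof. exact: cong_sym. Qed.

(** Changes [f] on the cone of [x].  Among the points of rank at least that of
    [x], only [x] itself lies in this cone. *)
Definition override (f : node W -> nat) x n :=
  fun y => if in_cone x y then n else f y.

Lemma in_cone_refl (x : node W) : in_cone x x.
Proof. by rewrite in_coneE eqxx. Qed.

Lemma override_ne f x n y : ord_rank x <= ord_rank y -> y <> x -> override f x n y = f y.
Proof.
move=> xy yx; rewrite /override in_coneE; have /eqP/negbTE -> := yx => /=.
case py: (parent y) => [z|] //=; case: ifP => // /rank_cone zx.
by have := lt_le_trans (rank_parent py) (le_trans zx xy); rewrite ltxx.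
Qed.

Lemma override_eq f x n : override f x n x = n.
Proof. by rewrite /override in_cone_refl. Qed.

(** Both values at [x] are reached from 0 by steps of 1, so they are linked
    through the function that vanishes on the cone. *)
Lemma msim_override a x n : exists2 b, ev b = override (ev a) x n &
  Below a ~[ord_rank x] Below b.
Proof.
have ov m : exists b, ev b = override (ev a) x m.
  exact/ev_onto/finite_jumps_override/ev_fin.
pose b m := sval (cid (ov m)); have bE m : ev (b m) = override (ev a) x m.
  by rewrite /b; case: cid.
have bS m : Below (b m) ~[ord_rank x] Below (b m.+1).
  apply: (@msim_step _ _ _ x) => //.
  - by move=> y xy yx; rewrite !bE !override_ne.
  - by rewrite !bE !override_eq.
  - by apply/ev_le => y; rewrite !bE /override; case: ifP.
have b0 m : Below (b 0) ~[ord_rank x] Below (b m).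
  by elim: m => [|m IH]; [exact: cong_refl|exact: msim_trans (bS m)].
exists (b n) => //; apply: msim_trans (b0 n).
apply: msim_trans (msim_sym (b0 (ev a x))).
apply/msim_cong/asboolP => y xy; rewrite bE.
have [->|/eqP yx] := eqVneq y x; first by rewrite override_eq.
by rewrite override_ne.
Qed.

Lemma msim_finite_diff v (s : seq (node W)) a b :
  (forall x, v <= ord_rank x -> ev a x <> ev b x -> ord_rank x = v /\ x \in s) ->
  Below a ~[v] Below b.
Proof.
elim: s a => [|x s IH] a abP.
  by apply/msim_cong/asboolP => x vx; apply: contrapT => /(abP x vx)[].
have [xv|xv] := eqVneq (ord_rank x) v; last first.
  apply: IH => y vy ne; have [yv] := abP y vy ne.
  by rewrite inE => /orP[/eqP E|//]; move: xv; rewrite -E yv eqxx.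
have [a' a'E aa'] := msim_override a x (ev b x).
move: aa'; rewrite xv => /msim_trans; apply; apply: IH => y vy.
rewrite a'E; have [->|/eqP yx] := eqVneq y x; first by rewrite override_eq.
rewrite override_ne ?xv // => ne; have [yv] := abP y vy ne.
by rewrite inE => /orP[/eqP|].
Qed.

(** Let two functions agree above rank [v].  At a point of rank [v] where they
    differ one of them has a jump, since they agree at its parent; so there are
    finitely many such points and they can be repaired one at a time.  At the
    last stage, the only remaining interval is that from the functions to the
    added top. *)
Lemma forest_cong_msim v w f g : is_succ v w -> K w f g -> f ~[v] g.
Proof.
move=> [vw wP].
have vtop a : w == \top -> Below a ~[v] Topmost.
  move=> /eqP wT; apply: msim_small; apply: small_interval_pi => //.
  case=> [c|] //= _ _; [left|by right].
  apply/asboolP => x; rewrite leNgt => /negP[].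
  by apply: lt_le_trans (ord_rank_lt_top x) (wP _ _); rewrite wT.
case: f g => [a|] [b|]; last (by move=> _; exact: cong_refl); last 2 first.
- exact: vtop.
- by move=> /vtop/msim_sym; apply.
move=> /asboolP ab; have [s sP] := ev_fin a; have [t tP] := ev_fin b.
apply: (@msim_finite_diff _ (s ++ t)) => x vx ne.
have xw : ord_rank x < w by rewrite ltNge; apply/negP => /ab.
have xv : ord_rank x = v by apply/le_anti; rewrite vx wP.
split=> //; rewrite mem_cat; apply/orP; apply: contrapT => /not_orP[xs xt].
apply: ne; have -> : ev a x = parent_value (ev a) x by apply: contrapT => /sP.
have -> : ev b x = parent_value (ev b) x by apply: contrapT => /tP.
rewrite /parent_value; case px: (parent x) => [y|] //=; apply: ab.
rewrite leNgt; apply/negP => /wP; rewrite -xv; apply/negP.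
by rewrite -ltNge ord_rank_lt (rank_parent px).
Qed.

(** If [f] is below [g] at a point [x] of rank above [v], then they also differ
    at a child [y] of [x] of rank [v] without jumps of [f] and [g].  Raising [f]
    by 1 on the cone of [y], but not above [g], gives a third element strictly
    between [f] and [g]: it differs from [f] at [y] and from [g] at [x].  If [g]
    is the added top, a root of rank [v] serves as [y]. *)
Lemma small_forest_cong v w f g : is_succ v w -> f <= g ->
  small_interval (pK v f) (pK v g) -> K w f g.
Proof.
move=> [vw wP] fg; apply: contraPP => nK.
have wT : w != \top.
  by apply/eqP => wT; apply: nK; case: f g {fg} => [a|] [b|]; rewrite wT //=;
    apply/asboolP; apply: agree_top.
have [v0 vE] : exists v0, v = Below (Below v0).
  by case: v w vw {wP nK} wT => [[v0|]|] [[w0|]|] //; exists v0.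
have up a y : exists c, ev c = fun x => (ev a x + in_cone y x)%N.
  by apply/ev_onto/(finite_jumps_op (op := addn)) => //; exact: finite_jumps_cone.
have vT : v == \top = false by rewrite vE.
case: f g fg nK => [a|] [b|] //= fg.
- move=> nK; have [x [wx ne]] : exists x, w <= ord_rank x /\ ev a x <> ev b x.
    apply: contrapT => nx; apply: nK; apply/asboolP => x wx.
    by apply: contrapT => ne; apply: nx; exists x.
  have ab y : (ev a y <= ev b y)%N by move: y; apply/ev_le.
  have abx : (ev a x < ev b x)%N by rewrite ltn_neqAle ab andbT; apply/eqP.
  have vx : v0 < rank x by have := lt_le_trans vw wx; rewrite vE !ltNge.
  have [s sP] := ev_fin a; have [t tP] := ev_fin b.
  have [z|y [yx yv]] := @exists_child _ _ (Some x) v0 (s ++ t); first by case=> <-.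
  rewrite mem_cat negb_or => /andP[/negP ys /negP yt].
  have ay : ev a y = ev a x.
    have -> : ev a y = parent_value (ev a) y by apply: contrapT => /sP.
    by rewrite /parent_value yx.
  have bxy : ev b y = ev b x.
    have -> : ev b y = parent_value (ev b) y by apply: contrapT => /tP.
    by rewrite /parent_value yx.
  have xy : in_cone y x = false.
    by apply/negP => /rank_cone; rewrite yv leNgt vx.
  have [c cE] := up a y.
  apply: (@not_small_interval_pi _ _ _ _ (Below (c `&` b))).
  + rewrite [_ <= _]lexI; apply/andP; split=> //.
    by apply/ev_le => z; rewrite cE leq_addr.
  + exact: leIr.
  + move=> /asboolP/(_ y); rewrite evI cE in_cone_refl vE /ord_rank yv lexx.
    rewrite ay bxy addn1 (minn_idPl abx) => /(_ isT) /eqP.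
    by rewrite -[X in X == _]addn0 -addn1 eqn_add2l.
  + move=> /asboolP/(_ x); rewrite evI cE xy addn0 => /(_ (le_trans (ltW vw) wx)).
    by rewrite (minn_idPl (ltnW abx)).
- move=> _; have [//|y [_ yv _]] := @exists_child _ _ None v0 [::].
  have [c cE] := up a y.
  apply: (@not_small_interval_pi _ _ _ _ (Below c)) => //=.
  + by apply/ev_le => z; rewrite cE leq_addr.
  + move=> /asboolP/(_ y); rewrite cE in_cone_refl vE /ord_rank yv lexx => /(_ isT) /eqP.
    by rewrite -[X in X == _]addn0 eqn_add2l.
  + by rewrite vT.
Qed.

(** In place of compactness at limit stages: finitely many ranks below a limit
    are bounded below it. *)
Lemma limit_above w (s : seq (node W)) : is_limit w ->
  exists2 v, v < w & forall x, x \in s -> ord_rank x < w -> ord_rank x < v.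
Proof.
move=> [[v0 v0w] wP]; elim: s => [|x s [v vw vP]]; first by exists v0.
have [xw|xw] := ltP (ord_rank x) w; last first.
  exists v => // y; rewrite inE => /orP[/eqP -> yw|]; last exact: vP.
  by move: xw; rewrite leNgt yw.
have [|u mu uw] := wP (Order.max (ord_rank x) v); first by rewrite gt_max xw.
exists u => // y; rewrite inE => /orP[/eqP -> _|ys yw]; apply: le_lt_trans mu.
  by rewrite le_max lexx.
by rewrite le_max (ltW (vP y ys yw)) orbT.
Qed.

(** At a limit stage [w], let two functions agree from rank [w] on and take [v]
    below [w] and above all ranks below [w] of their jumps.  A point of rank
    between [v] and [w] inherits its values from its parent, so the functions
    agree from rank [v] on. *)
Theorem forest_has_mdim : inhabited W -> has_mdim (topped T) W.
Proof.
move=> [w0]; split; first by exists (Below \bot), Topmost.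
exists K; split=> [||w wT].
- split=> [w w0P f g|v w vw f g|w wl f g].
  + split=> [|->]; last exact: cong_refl.
    have /negbTE wT : w != \top.
      by apply/eqP => wT; have := w0P (Below Topmost); rewrite wT.
    case: f g => [a|] [b|] //=; rewrite ?wT // => /asboolP ab.
    by congr Below; apply: ev_inj; apply: funext => x; apply: ab.
  + split; first exact: forest_cong_msim.
    apply: msim_min => [h k|h k]; last exact: small_forest_cong.
    by apply: forest_cong_mono; apply: ltW; case: vw.
  + split=> [|[v vw]]; last by apply: forest_cong_mono; apply: ltW.
    have /negbTE wT : w != \top.
      apply/eqP => wT; have [_ wl2] := wl.
      have := wl2 (Below Topmost); rewrite wT => /(_ isT)[].
      by case=> [[u|]|].
    case: f g => [a|] [b|] //=; rewrite ?wT //; last first.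
      by move=> _; have [[v vw] _] := wl; exists v.
    move=> /asboolP ab.
    have [s sP] := ev_fin a; have [t tP] := ev_fin b.
    have [v vw vP] := limit_above (s ++ t) wl.
    exists v => //; apply/asboolP; apply: node_ind => x IH vx.
    have [wx|xw] := leP w (ord_rank x); first exact: ab.
    have xst : x \in s ++ t -> False.
      by move=> /vP/(_ xw); rewrite ltNge vx.
    have -> : ev a x = parent_value (ev a) x.
      by apply: contrapT => /sP xs; apply: xst; rewrite mem_cat xs.
    have -> : ev b x = parent_value (ev b) x.
      by apply: contrapT => /tP xt; apply: xst; rewrite mem_cat xt orbT.
    rewrite /parent_value; case px: (parent x) => [y|] //=.
    by apply: IH => //; apply: le_trans vx (ltW _); rewrite ord_rank_lt (rank_parent px).
- exists (pK \top (Below \bot)); elim/quotW => f; apply/pi_cquotP.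
  by case: f => [a|] //=; apply/asboolP; apply: agree_top.
- move=> [p pP].
  have /pi_cquotP /= : pK w (Below \bot) = pK w Topmost.
    exact: etrans (pP _) (esym (pP _)).
  by move: wT; rewrite lt_neqAle => /andP[/negbTE ->].
Qed.

End ForestLattice.

(** * Bezout domains whose divisibility is a pointwise order *)

Section ValuedBezout.
Context (R : bezoutDomainType) (X : Type) (v : R -> X -> nat).
Context (D : (X -> nat) -> Prop).
Context (vM : forall a b : R, a != 0%R -> b != 0%R ->
  forall x, v (a * b)%R x = (v a x + v b x)%N).
Context (v_dvd : forall a b : R, a != 0%R -> b != 0%R ->
  (forall x, (v a x <= v b x)%N) -> exists c, b = (c * a)%R).
Context (v_D : forall a, a != 0%R -> D (v a)).
Context (v_onto : forall f, D f -> exists2 a, a != 0%R & v a = f).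
Context (D_min : forall f g, D f -> D g -> D (fun x => minn (f x) (g x))).
Context (D_bounded : forall f, D f -> exists n, forall x, (f x <= n)%N).
Implicit Types a b c : R.

Lemma value_le_mul a b : a != 0%R -> (b * a)%R != 0%R ->
  forall x, (v a x <= v (b * a)%R x)%N.
Proof.
move=> a0 ba0 x; rewrite vM // ?leq_addl //.
by apply: contraNneq ba0 => ->; rewrite mul0r.
Qed.

(** A generator of the ideal of [a] and [b] divides both of them, and is divided
    by any element whose value is the pointwise minimum. *)
Lemma value_gcd a b : a != 0%R -> b != 0%R -> exists g,
  [/\ g != 0%R, forall x, v g x = minn (v a x) (v b x),
      exists r s, g = (r * a + s * b)%R,
      exists r, a = (r * g)%R & exists s, b = (s * g)%R].
Proof.
move=> a0 b0; have [g [[r [s gE]] [r' [s' [aE bE]]]]] := bezout_gcd a b.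
have g0 : g != 0%R by apply: contraNneq a0 => g0; rewrite aE g0 mulr0.
exists g; split; [by []| |by exists r, s|by exists r'|by exists s'].
move=> x; apply/anti_leq/andP; split.
  by rewrite leq_min {1}aE {1}bE !value_le_mul -?aE -?bE.
have [h h0 hE] := v_onto (D_min (v_D a0) (v_D b0)).
have [|u uE] := v_dvd h0 a0; first by move=> y; rewrite hE geq_minl.
have [|w wE] := v_dvd h0 b0; first by move=> y; rewrite hE geq_minr.
have gh : g = ((r * u + s * w) * h)%R by rewrite gE {1}uE {1}wE; ring.
by rewrite gh in g0 *; have := value_le_mul h0 g0 x; rewrite hE.
Qed.

Lemma value_add_ge a b : a != 0%R -> b != 0%R -> (a + b)%R != 0%R ->
  forall x, (minn (v a x) (v b x) <= v (a + b)%R x)%N.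
Proof.
move=> a0 b0 ab0 x; have [g [g0 gE _ [r aE] [s bE]]] := value_gcd a0 b0.
have E : (a + b = (r + s) * g)%R by rewrite {1}aE {1}bE; ring.
by rewrite -gE E value_le_mul // -E.
Qed.

Lemma value1 x : v 1%R x = 0%N.
Proof.
have := vM (oner_neq0 R) (oner_neq0 R) x; rewrite mulr1.
by move=> /esym/eqP; rewrite -[X in _ == X]addn0 eqn_add2l => /eqP.
Qed.

Lemma valueX a n x : a != 0%R -> v (a ^+ n)%R x = (n * v a x)%N.
Proof.
move=> a0; elim: n => [|n IH]; first by rewrite expr0 value1.
by rewrite exprS vM ?expf_neq0 // IH mulSn.
Qed.

(** This is the hyperarchimedean property.  For [b] in [Q] and [n] a bound of the
    values of [a], the values of [b ^+ n] exceed those of [a] wherever [b] has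
    nonzero value.  So [e], the quotient of [a] by its gcd with [b ^+ n], has
    value 0 wherever [b] has not, and generates the unit ideal together with
    [b].  Since [Q] is proper, [e] cannot lie in [P]; hence the gcd does, and then
    so do [b ^+ n] and [b]. *)
Lemma nonzero_prime_maximal (P Q : {pred R}) a : prime_ideal P -> prime_ideal Q ->
  a != 0%R -> a \in P -> {subset P <= Q} -> {subset Q <= P}.
Proof.
move=> [[P0 P1 PI] PM] [[Q0 Q1 QI] _] a0 aP PQ b bQ.
have [->//|b0] := eqVneq b 0%R.
have mulP r c : c \in P -> (r * c)%R \in P.
  by move=> cP; rewrite -[(r * c)%R]addr0; apply: PI.
have mulQ r c : c \in Q -> (r * c)%R \in Q.
  by move=> cQ; rewrite -[(r * c)%R]addr0; apply: QI.
have [n nP] := D_bounded (v_D a0).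
have bn0 : (b ^+ n)%R != 0%R by rewrite expf_neq0.
have [g [g0 gE _ [e aE] [u uE]]] := value_gcd a0 bn0.
have e0 : e != 0%R by apply: contraNneq a0 => e0; rewrite aE e0 mul0r.
have eE x : v e x = (v a x - minn (v a x) (n * v b x))%N.
  by rewrite -valueX // -gE {1}aE vM // addnK.
have : (e * g)%R \in P by rewrite -aE.
move=> /PM/orP[eP|gP]; last first.
  have bnP k : (b ^+ k)%R \in P -> b \in P.
    elim: k => [|k IH]; first by rewrite expr0 => /(negP P1).
    by rewrite exprS => /PM/orP[].
  by apply: (bnP n); rewrite uE mulP.
have [h [h0 hE [r [s hrs]] _ _]] := value_gcd e0 b0.
have [|k kE] := v_dvd h0 (oner_neq0 R).
  move=> x; rewrite value1 hE eE leqn0; apply/eqP.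
  have [->|bx] := posnP (v b x); first by rewrite minn0.
  suff /minn_idPl -> : (v a x <= n * v b x)%N by rewrite subnn min0n.
  by apply: leq_trans (nP x) _; rewrite leq_pmulr.
case/negP: Q1; rewrite kE hrs; apply/mulQ/QI; first exact: PQ.
exact: mulQ.
Qed.

(** The zero ideal is properly contained in the center of the valuation at
    [x0]. *)
Lemma valued_krull_dim1 x0 a0 : a0 != 0%R -> (0 < v a0 x0)%N -> has_krull_dim R 1.
Proof.
move=> a00 va0.
have zero_prime : prime_ideal (pred1 (0%R : R)).
  split; first split; rewrite ?inE ?oner_neq0 //.
    by move=> r a b; rewrite !inE => /eqP -> /eqP ->; rewrite mulr0 addr0.
  by move=> a b; rewrite !inE mulf_eq0.
pose P1 : {pred R} := fun a => (a == 0%R) || (0 < v a x0)%N.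
have P1E a : (a \in P1) = (a == 0%R) || (0 < v a x0)%N by [].
have P1_prime : prime_ideal P1.
  split; first split; rewrite ?P1E ?eqxx ?oner_eq0 ?value1 //.
    move=> r a b; rewrite !P1E.
    have [->|a1] := eqVneq a 0%R; first by rewrite mulr0 add0r.
    have [->|r1] := eqVneq r 0%R; first by rewrite mul0r add0r.
    have [->|b1] := eqVneq b 0%R.
      rewrite addr0 mulf_eq0 (negbTE a1) (negbTE r1) vM //= addn_gt0.
      by move=> -> /=; rewrite orbT.
    have [//|ab1] := eqVneq (r * a + b)%R 0%R; rewrite /= => va vb.
    have ra0 : (r * a)%R != 0%R by rewrite mulf_neq0.
    apply: leq_trans (value_add_ge ra0 b1 ab1 x0).
    by rewrite leq_min vb vM // addn_gt0 va orbT.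
  move=> a b; rewrite !P1E mulf_eq0.
  have [-> //|a1] := eqVneq a 0%R.
  have [->|b1] := eqVneq b 0%R; first by move=> _; rewrite orbT.
  by rewrite vM //= addn_gt0.
split.
  exists (fun n => if n is 0 then (pred1 (0%R : R) : {pred R}) else P1).
  split=> [[|i] _|[|//] _]; [exact: zero_prime|exact: P1_prime|split].
    by move=> a; rewrite inE P1E => ->.
  by exists a0; rewrite ?P1E ?va0 ?orbT // inE.
move=> m P [Ppr Pch]; rewrite leqNgt; apply/negP => m1.
have [P01 [a aP1 aP0]] := Pch 0 (ltnW m1); have [P12 [b bP2 bP1]] := Pch 1 m1.
have a1 : a != 0%R.
  by apply: contraNneq aP0 => ->; have [[]] := Ppr 0 isT.
have := nonzero_prime_maximal (Ppr 1 (ltnW m1)) (Ppr 2 m1) a1 aP1 P12 bP2.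
by rewrite (negbTE bP1).
Qed.

Lemma gamma_pos_rep (a : gamma_pos R) :
  exists2 r, r != 0%R & val (repr (val a)) = r%:F%R.
Proof.
have : frac_le (exist (fun a : {fraction R} => a != 0%R) 1%R (oner_neq0 _))
    (repr (val a)).
  by rewrite -gamma_le_pi reprK; exact: (valP a).
move=> /frac_leP[r /= rE]; rewrite mul1r in rE.
exists r => //; rewrite -tofrac_eq0 -rE; exact: (valP (repr (val a))).
Qed.

(** A class of the positive cone is represented by a nonzero element of the ring,
    unique up to units. *)
Definition pos_value (a : gamma_pos R) : X -> nat :=
  v (s2val (cid2 (gamma_pos_rep a))).

Lemma frac_le_value r s (fr fs : frac_unit R) : r != 0%R -> s != 0%R ->
  val fr = r%:F%R -> val fs = s%:F%R ->
  frac_le fr fs <-> forall x, (v r x <= v s x)%N.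
Proof.
move=> r0 s0 frE fsE; split.
  move=> /frac_leP[u]; rewrite frE fsE -rmorphM => /eqP; rewrite tofrac_eq.
  by move=> /eqP E; rewrite E mulrC; apply: value_le_mul; rewrite // mulrC -E.
move=> /(v_dvd r0 s0)[u uE]; apply/frac_leP; exists u.
by rewrite frE fsE uE rmorphM mulrC.
Qed.

Lemma pos_value_le (a b : gamma_pos R) :
  a <= b <-> forall x, (pos_value a x <= pos_value b x)%N.
Proof.
rewrite /pos_value; case: (cid2 _) => r r0 rE; case: (cid2 _) => s s0 sE /=.
exact: (frac_le_value r0 s0 rE sE).
Qed.

Lemma pos_value_D (a : gamma_pos R) : D (pos_value a).
Proof. by rewrite /pos_value; case: (cid2 _) => r r0 rE; exact: v_D. Qed.

Lemma pos_value_onto f : D f -> exists a : gamma_pos R, pos_value a = f.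
Proof.
move=> /v_onto[r r0 <-].
have rF : r%:F%R != 0%R :> {fraction R} by rewrite tofrac_eq0.
pose fr : frac_unit R := exist (fun a : {fraction R} => a != 0%R) _ rF.
have r1 : gamma1 R <= \pi_(Gamma R) fr.
  by rewrite [_ <= _]gamma_le_pi; apply/frac_leP; exists r; rewrite /= mul1r.
exists (exist (fun g : Gamma R => gamma1 R <= g) _ r1).
rewrite /pos_value; case: (cid2 _) => s s0 /= sE.
have frE : val fr = r%:F%R by [].
have := gamma_le_pi (repr (\pi_(Gamma R) fr)) fr.
have := gamma_le_pi fr (repr (\pi_(Gamma R) fr)).
rewrite reprK gamma_le_refl => /esym rs /esym sr.
have {}rs := (frac_le_value r0 s0 frE sE).1 rs.
have {}sr := (frac_le_value s0 r0 sE frE).1 sr.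
by apply: funext => x; apply/anti_leq; rewrite rs sr.
Qed.

End ValuedBezout.

Local Open Scope ring_scope.

(** * Kronecker function rings *)

Section ClassicalInverse.
Context (T : comNzRingType).

(** An inverse by choice, for rings whose units are not otherwise described. *)
Definition classical_unit : {pred T} := fun x => `[< exists y, y * x = 1 >].

Definition classical_inv (x : T) : T :=
  if pselect (exists y, y * x = 1) is left h then sval (cid h) else x.

Lemma classical_mulVr : {in classical_unit, left_inverse 1 classical_inv *%R}.
Proof.
move=> x /asboolP ux; rewrite /classical_inv; case: pselect => // h.
by case: (cid h).
Qed.

Lemma classical_unitPl (x y : T) : y * x = 1 -> classical_unit x.
Proof. by move=> yx; apply/asboolP; exists y. Qed.

Lemma classical_inv_out : {in [predC classical_unit], classical_inv =1 id}.
Proof. by move=> x /asboolP nu; rewrite /classical_inv; case: pselect. Qed.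

End ClassicalInverse.

Lemma bezout_fg_principal (R : comNzRingType) :
  (forall a b : R, exists g, [/\ exists r s, g = r * a + s * b,
     exists r, a = r * g & exists s, b = s * g]) ->
  forall s : seq R, exists a, forall x, fg_ideal s x <-> principal_ideal a x.
Proof.
move=> gcdP; elim=> [|b s [a aP]].
  exists 0 => x; split=> [[c ->]|[r ->]]; first by exists 0; rewrite big_ord0 mul0r.
  by exists (fun=> 0); rewrite big_ord0 mulr0.
have [g [[r [t gE]] [u bE] [w aE]]] := gcdP b a.
exists g => x; split=> [[c ->]|[k ->]].
  rewrite big_ord_recl /=.
  have /aP[e ->] : fg_ideal s (\sum_(i < size s) c (lift ord0 i) * s`_i).
    by exists (fun i => c (lift ord0 i)).
  by exists (c ord0 * u + e * w); rewrite {1}bE {1}aE; ring.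
have /aP[c cE] : principal_ideal a (k * t * a) by exists (k * t).
exists (fun i => oapp c (k * r) (unlift ord0 i)).
rewrite big_ord_recl unlift_none /= gE mulrDr !mulrA; congr (_ + _).
by rewrite cE; apply: eq_bigr => i _; rewrite liftK.
Qed.

(** Discrete valuations indexed by [X], whose values at 0 are irrelevant.  The
    last field is what makes the Kronecker function ring Bezout: combinations
    with integer coefficients attain the minimum at all points at once. *)
Record valuation_family (A : idomainType) (X : Type) := ValuationFamily {
  valuation :> A -> X -> nat;
  valuationM : forall p q, p != 0 -> q != 0 ->
    forall x, valuation (p * q) x = (valuation p x + valuation q x)%N;
  valuationB : forall p q, p != 0 -> q != 0 -> p - q != 0 ->
    forall x, (minn (valuation p x) (valuation q x) <= valuation (p - q) x)%N;
  valuation_min : forall p q, p != 0 -> q != 0 -> exists n : nat,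
    p + q *+ n != 0 /\
    forall x, valuation (p + q *+ n) x = minn (valuation p x) (valuation q x) }.

(* Stated over an abstract field, where [field] has no construction of
   fractions to unfold. *)
Lemma subr_div_div (K : fieldType) (a b c e : K) : b != 0 -> e != 0 ->
  a / b - c / e = (a * e - c * b) / (b * e).
Proof. by move=> b0 e0; field; rewrite b0 e0. Qed.

Lemma addr_div_mulrn (K : fieldType) (a b c e : K) n : b != 0 -> e != 0 ->
  a / b + (c / e) *+ n = (a * e + (c * b) *+ n) / (b * e).
Proof.
by move=> b0 e0; rewrite -mulr_natr -(mulr_natr (c * b)); field; rewrite b0 e0.
Qed.

Lemma div_mul_cross (K : fieldType) (a b c e : K) :
    a != 0 -> b != 0 -> e != 0 ->
  c / e = (c * b) / (e * a) * (a / b).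
Proof. by move=> a0 b0 e0; field; rewrite a0 b0 e0. Qed.

Lemma fraction_num_den (A : idomainType) (z : {fraction A}) : exists pq : A * A,
  pq.2 != 0 /\ z = pq.1%:F / pq.2%:F.
Proof.
elim/quotW: z => z; exists (\n_z, \d_z); split; first exact: denom_ratioP.
have d0 : (\d_z)%:F != 0 :> {fraction A} by rewrite tofrac_eq0 denom_ratioP.
apply: (mulIf d0); rewrite divfK //; unlock FracField.tofrac.
rewrite -[LHS]FracField.pi_mul; apply/eqmodP.
rewrite -[equiv _ _ _]/(FracField.equivf _ _) /FracField.equivf /FracField.mulf.
by rewrite !numden_Ratio ?mulr1 ?oner_neq0 ?denom_ratioP 1?mulrC.
Qed.

Section Kronecker.
Context (A : idomainType) (X : Type) (v : valuation_family A X).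
Local Notation F := {fraction A}.
Implicit Types p q : A.

(** The element 0 has value above everything. *)
Definition val_ge p (u : X -> nat) := p = 0 \/ forall x, (u x <= v p x)%N.

Lemma val_geE p u : p != 0 -> val_ge p u <-> forall x, (u x <= v p x)%N.
Proof. by move=> p0; split=> [[p00|//]|]; [rewrite p00 eqxx in p0|right]. Qed.

Lemma val_ge_self p : val_ge p (v p).
Proof. by right. Qed.

Lemma valuation1 x : v 1 x = 0%N.
Proof.
have := valuationM v (oner_neq0 A) (oner_neq0 A) x; rewrite mulr1.
by move=> /esym/eqP; rewrite -[X in _ == X]addn0 eqn_add2l => /eqP.
Qed.

Lemma val_geB p q u : val_ge p u -> val_ge q u -> val_ge (p - q) u.
Proof.
have [pq0|pq0] := eqVneq (p - q) 0; first by left.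
have [p0|p0] := eqVneq p 0.
  have [q0|q0] := eqVneq q 0; first by rewrite p0 q0 subrr; left.
  have N1 : (-1 : A) != 0 by rewrite oppr_eq0 oner_neq0.
  have cN1 x : v (-1) x = 0%N.
    have /eqP := valuationM v N1 N1 x; rewrite mulrNN mulr1 valuation1 eq_sym.
    by rewrite addn_eq0 andbb => /eqP.
  move=> _ /(val_geE _ q0) qu; right=> x.
  by rewrite p0 sub0r -mulN1r valuationM // cN1.
have [->|q0] := eqVneq q 0; first by rewrite subr0.
move=> /(val_geE _ p0) pu /(val_geE _ q0) qu; right=> x.
by apply: leq_trans (valuationB v p0 q0 pq0 x); rewrite leq_min pu qu.
Qed.

Lemma val_geM p q u w : val_ge p u -> val_ge q w ->
  val_ge (p * q) (fun x => u x + w x)%N.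
Proof.
have [->|p0] := eqVneq p 0; first by rewrite mul0r; left.
have [->|q0] := eqVneq q 0; first by rewrite mulr0; left.
move=> /(val_geE _ p0) pu /(val_geE _ q0) qw; right=> x.
by rewrite valuationM // leq_add.
Qed.

Definition num (z : F) : A := (sval (cid (fraction_num_den z))).1.
Definition den (z : F) : A := (sval (cid (fraction_num_den z))).2.

Lemma den_neq0 z : den z != 0.
Proof. by rewrite /den; case: cid => ? []. Qed.

Lemma num_den z : z = (num z)%:F / (den z)%:F.
Proof. by rewrite /num /den; case: cid => ? []. Qed.

Lemma num_neq0 z : z != 0 -> num z != 0.
Proof. by apply: contraNneq => z0; rewrite [z]num_den z0 rmorph0 mul0r. Qed.

Lemma frac_eqP (p q p' q' : A) : q != 0 -> q' != 0 ->
  p%:F / q%:F = p'%:F / q'%:F :> F -> p * q' = p' * q.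
Proof.
move=> q0 q'0 /eqP; rewrite eqr_div ?tofrac_eq0 // -!rmorphM tofrac_eq.
by move=> /eqP.
Qed.

Lemma valuation_frac_eq (p q p' q' : A) : p != 0 -> p' != 0 -> q != 0 -> q' != 0 ->
  p%:F / q%:F = p'%:F / q'%:F :> F ->
  forall x, (v p x + v q' x = v p' x + v q x)%N.
Proof.
by move=> p0 p'0 q0 q'0 /(frac_eqP q0 q'0) E x; rewrite -!valuationM // E.
Qed.

(** The condition does not depend on the chosen numerator and denominator, by
    [mem_kronecker]. *)
Definition kronecker_pred : {pred F} := fun z => `[< val_ge (num z) (v (den z)) >].

Lemma mem_kronecker (p q : A) : q != 0 ->
  (p%:F / q%:F \in kronecker_pred) <-> val_ge p (v q).
Proof.
move=> q0; set z := p%:F / q%:F.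
have [zE z0] := (num_den z, den_neq0 z).
have E := frac_eqP q0 z0 zE.
have [p0|p0] := eqVneq p 0.
  have nz0 : num z = 0.
    by apply: (mulIf q0); rewrite -E p0 !mul0r.
  by rewrite p0; split=> _; [left|apply/asboolP; rewrite nz0; left].
have nz0 : num z != 0.
  apply: contraNneq p0 => nz; rewrite nz mul0r in E.
  by move/eqP: E; rewrite mulf_eq0 (negbTE z0) orbF.
have cE := valuation_frac_eq p0 nz0 q0 z0 zE.
split.
  move=> /asboolP/(val_geE _ nz0) h; apply/val_geE => // x.
  by have := cE x; have := h x; lia.
move=> /(val_geE _ p0) h; apply/asboolP/val_geE => // x.
by have := cE x; have := h x; lia.
Qed.

Fact kronecker_subring : subring_closed kronecker_pred.
Proof.
have cM (y z : F) : v (den y * den z) = fun x => (v (den y) x + v (den z) x)%N.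
  by apply: funext => x; rewrite valuationM ?den_neq0.
have d0 (y : F) : (den y)%:F != 0 :> F by rewrite tofrac_eq0 den_neq0.
have dd0 (y z : F) : den y * den z != 0 by rewrite mulf_neq0 ?den_neq0.
split=> [|y z /asboolP yK /asboolP zK|y z /asboolP yK /asboolP zK].
- rewrite -[1](divr1 1) -(rmorph1 (@FracField.tofrac A)).
  by apply/mem_kronecker; rewrite ?oner_neq0 //; exact: val_ge_self.
- have -> : y - z = (num y * den z - num z * den y)%:F / (den y * den z)%:F.
    by rewrite {1}[y]num_den {1}[z]num_den subr_div_div ?d0 // rmorphB !rmorphM.
  apply/mem_kronecker => //; rewrite cM; apply: val_geB.
    by apply: val_geM => //; exact: val_ge_self.
  rewrite mulrC; apply: val_geM => //; exact: val_ge_self.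
- have -> : y * z = (num y * num z)%:F / (den y * den z)%:F.
    by rewrite {1}[y]num_den {1}[z]num_den mulf_div !rmorphM.
  by apply/mem_kronecker => //; rewrite cM; apply: val_geM.
Qed.

HB.instance Definition _ := GRing.isSubringClosed.Build F kronecker_pred
  kronecker_subring.

Definition kronecker := {z : F | z \in kronecker_pred}.

HB.instance Definition _ := SubChoice.on kronecker.
HB.instance Definition _ := [SubChoice_isSubComNzRing of kronecker by <:].

Fact kronecker_integral : GRing.integral_domain_axiom kronecker.
Proof.
move=> a b /(congr1 val)/eqP; rewrite rmorphM rmorph0 mulf_eq0.
by rewrite -(rmorph0 (val : kronecker -> F)) !(inj_eq val_inj).
Qed.

HB.instance Definition _ := GRing.ComNzRing_hasMulInverse.Build kronecker
  (@classical_mulVr kronecker) (@classical_unitPl kronecker)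
  (@classical_inv_out kronecker).
HB.instance Definition _ := GRing.ComUnitRing_isIntegral.Build kronecker
  kronecker_integral.

(** For a nonzero [a] the subtraction does not truncate, as [a] is in the ring. *)
Definition kronecker_val (a : kronecker) : X -> nat := fun x =>
  (v (num (val a)) x - v (den (val a)) x)%N.

Lemma val_kroneckerM (a b : kronecker) : val (a * b) = val a * val b.
Proof. exact: (rmorphM (val : kronecker -> F)). Qed.

Lemma val_neq0 (a : kronecker) : a != 0 -> val a != 0.
Proof. by apply: contra_neq => a0; apply: val_inj; rewrite a0 rmorph0. Qed.

Lemma val_neq0_inv (a : kronecker) : val a != 0 -> a != 0.
Proof. by apply: contra_neq => ->; rewrite rmorph0. Qed.

Lemma kronecker_val_frac (a : kronecker) (p q : A) : p != 0 -> q != 0 ->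
  val a = p%:F / q%:F ->
  forall x, v p x = (kronecker_val a x + v q x)%N.
Proof.
move=> p0 q0 aE x.
have a0 : val a != 0 by rewrite aE mulf_neq0 ?invr_eq0 ?tofrac_eq0.
have nz := num_neq0 a0; have := num_den (val a); rewrite {1}aE.
move=> /(valuation_frac_eq p0 nz q0 (den_neq0 _))/(_ x) E.
have /asboolP/(val_geE _ nz)/(_ x) := valP a.
by rewrite /kronecker_val; lia.
Qed.

Lemma kronecker_valM (a b : kronecker) : a != 0 -> b != 0 ->
  forall x, kronecker_val (a * b) x = (kronecker_val a x + kronecker_val b x)%N.
Proof.
move=> /val_neq0 a0 /val_neq0 b0 x.
have [na nb] := (num_neq0 a0, num_neq0 b0).
have [da db] := (den_neq0 (val a), den_neq0 (val b)).
have E : val (a * b) =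
    (num (val a) * num (val b))%:F / (den (val a) * den (val b))%:F.
  by rewrite val_kroneckerM {1}[val a]num_den {1}[val b]num_den mulf_div !rmorphM.
have := kronecker_val_frac _ _ E x; rewrite !mulf_neq0 // => /(_ isT isT).
rewrite !valuationM // (kronecker_val_frac na da (num_den _)).
rewrite (kronecker_val_frac nb db (num_den _)).
lia.
Qed.

Lemma kronecker_val_dvd (a b : kronecker) : a != 0 -> b != 0 ->
  (forall x, (kronecker_val a x <= kronecker_val b x)%N) -> exists c, b = c * a.
Proof.
move=> /val_neq0 a0 /val_neq0 b0 ab.
have [na nb] := (num_neq0 a0, num_neq0 b0).
have [da db] := (den_neq0 (val a), den_neq0 (val b)).
set c : F := (num (val b) * den (val a))%:F / (den (val b) * num (val a))%:F.
have cK : c \in kronecker_pred.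
  apply/mem_kronecker; first by rewrite mulf_neq0.
  apply/val_geE; first by rewrite mulf_neq0.
  move=> x; rewrite !valuationM // (kronecker_val_frac na da (num_den _)).
  rewrite (kronecker_val_frac nb db (num_den _)).
  by have := ab x; lia.
exists (Sub c cK); apply: val_inj; rewrite val_kroneckerM SubK /c.
rewrite {1}[val b]num_den {3}[val a]num_den !rmorphM.
by apply: div_mul_cross; rewrite tofrac_eq0.
Qed.

Lemma kronecker_embed (p : A) : p != 0 ->
  exists2 a : kronecker, a != 0 & kronecker_val a = v p.
Proof.
move=> p0; have one0 := oner_neq0 A.
have pK : p%:F / 1%:F \in kronecker_pred.
  by apply/mem_kronecker => //; right=> x; rewrite valuation1.
pose a : kronecker := Sub (p%:F / 1%:F) pK.
have aE : val a = p%:F / 1%:F by exact: SubK.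
exists a; first by apply: val_neq0_inv; rewrite aE mulf_neq0 ?invr_eq0 ?tofrac_eq0.
apply: funext => x.
by have := kronecker_val_frac p0 one0 aE x; rewrite valuation1 addn0.
Qed.

Lemma kronecker_bezout (a b : kronecker) :
  exists g, [/\ exists r s, g = r * a + s * b,
     exists r, a = r * g & exists s, b = s * g].
Proof.
have [->|a0] := eqVneq a 0.
  by exists b; split; [exists 0, 1|exists 0|exists 1]; ring.
have [->|b0] := eqVneq b 0.
  by exists a; split; [exists 1, 0|exists 1|exists 0]; ring.
have [va0 vb0] : val a != 0 /\ val b != 0 by split; exact: val_neq0.
have [na nb] := (num_neq0 va0, num_neq0 vb0).
have [da db] := (den_neq0 (val a), den_neq0 (val b)).
have [n] := valuation_min v (mulf_neq0 na db) (mulf_neq0 nb da).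
set h := (_ + _) => -[h0 hE].
set g := a + b *+ n.
have gE : val g = h%:F / (den (val a) * den (val b))%:F.
  rewrite (_ : val g = val a + val b *+ n); last first.
    by rewrite -(rmorphMn (val : kronecker -> F)) -(rmorphD (val : kronecker -> F)).
  rewrite {1}[val a]num_den {1}[val b]num_den /h.
  by rewrite addr_div_mulrn ?tofrac_eq0 // rmorphD rmorphMn !rmorphM.
have dd0 : den (val a) * den (val b) != 0 by rewrite mulf_neq0.
have gv x : kronecker_val g x = minn (kronecker_val a x) (kronecker_val b x).
  have aE := kronecker_val_frac na da (num_den _) x.
  have bE := kronecker_val_frac nb db (num_den _) x.
  have := kronecker_val_frac h0 dd0 gE x; rewrite hE !valuationM // aE bE.
  rewrite -!addnA (addnC (v (den (val b)) x)) -addn_minl => /esym/eqP.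
  by rewrite eqn_add2r => /eqP.
have g0 : g != 0.
  by apply: val_neq0_inv; rewrite gE mulf_neq0 ?invr_eq0 ?tofrac_eq0.
exists g; split.
- by exists 1, n%:R; rewrite /g -mulr_natr; ring.
- by apply: kronecker_val_dvd => // x; rewrite gv geq_minl.
- by apply: kronecker_val_dvd => // x; rewrite gv geq_minr.
Qed.

HB.instance Definition _ := IntegralDomain_isBezout.Build kronecker
  (bezout_fg_principal kronecker_bezout).

End Kronecker.

(** * The monoid algebra of functions with finitely many jumps *)

(** Compare [wt] first, and then the values at the least point of difference for
    some well-ordering of [X]. *)
Lemma term_order (X : eqType) (wt : (X -> nat) -> nat) :
    (forall f g, wt (fun x => f x + g x)%N = (wt f + wt g)%N) ->
  exists lt : (X -> nat) -> (X -> nat) -> Prop,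
  [/\ forall f, ~ lt f f,
      forall f g h, lt f g -> lt g h -> lt f h,
      forall f g, f <> g -> lt f g \/ lt g f,
      forall f g h, lt f g -> lt (fun x => f x + h x)%N (fun x => g x + h x)%N
    & forall f g, lt f g -> (wt f <= wt g)%N].
Proof.
move=> wtD; have [R Rwo] := well_ordering_principle X.
have Rwo' : wo_chain R predT by apply: withinW.
have Rtotal x y : R x y || R y x by apply: (wo_chainW Rwo').
have Ranti x y : R x y -> R y x -> x = y.
  by move=> xy yx; apply: (wo_chain_antisymmetric Rwo') => //; rewrite xy yx.
have Rtrans x y z : R x y -> R y z -> R x z.
  move=> xy yz; have [|t [[]]] := Rwo (pred3 x y z).
    by exists x; rewrite !inE eqxx.
  rewrite !inE => /or3P[] /eqP -> tP _.
  - by apply: tP; rewrite !inE eqxx !orbT.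
  - by rewrite (Ranti x y) // tP // !inE eqxx ?orbT.
  - by rewrite -(Ranti y z) ?tP // !inE eqxx ?orbT.
pose lex (f g : X -> nat) :=
  exists2 x, (f x < g x)%N & forall y, f y <> g y -> R x y.
have lex_trans f g h : lex f g -> lex g h -> lex f h.
  move=> [x fgx xP] [y ghy yP].
  have [xy|yx] := orP (Rtotal x y); [exists x|exists y].
  - apply: leq_trans fgx _; have [->//|/eqP/yP yx] := eqVneq (g x) (h x).
    by rewrite (Ranti x y) // ltnW.
  - move=> z fhz; have [E|/eqP/xP//] := eqVneq (f z) (g z).
    by apply: Rtrans xy (yP z _); rewrite -E.
  - apply: leq_ltn_trans ghy; have [->//|/eqP/xP xy] := eqVneq (f y) (g y).
    by rewrite (Ranti y x) // ltnW.
  - move=> z fhz; have [E|/eqP/yP//] := eqVneq (g z) (h z).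
    by apply: Rtrans yx (xP z _); rewrite E.
have lex_total f g : f <> g -> lex f g \/ lex g f.
  move=> fg; have [|x [[]]] := Rwo (fun x => f x != g x).
    apply: contrapT => nfg; apply: fg; apply: funext => x.
    by apply: contrapT => /eqP fgx; apply: nfg; exists x.
  rewrite unfold_in neq_ltn => /orP[] fgx xP _; [left|right];
    by exists x => // y /eqP yP; apply: xP; rewrite unfold_in // eq_sym.
exists (fun f g => (wt f < wt g)%N \/ wt f = wt g /\ lex f g); split.
- by move=> f [|[_ [x]]]; rewrite ltnn.
- move=> f g h [fg|[fg l]] [gh|[gh l']]; last first.
  + by right; rewrite fg gh; split; [|exact: lex_trans l l'].
  + by left; rewrite fg.
  + by left; rewrite -gh.
  + by left; apply: ltn_trans fg gh.
- move=> f g fg; have [lfg|lfg|E] := ltngtP (wt f) (wt g); first by left; left.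
    by right; left.
  by case: (lex_total f g fg); [left|right]; right.
- move=> f g h; rewrite !wtD => -[fg|[-> [x fgx xP]]].
    by left; rewrite ltn_add2r.
  right; split=> //; exists x; first by rewrite ltn_add2r.
  by move=> y fgy; apply: xP => E; apply: fgy; rewrite E.
- by move=> f g [/ltnW|[->]].
Qed.

Section Monomials.
Context {d : Order.disp_t} (W : orderType d).

(** Nonnegative functions under addition, written multiplicatively as exponents
    of monomials. *)
Definition monomial := {f : node W -> nat | `[< finite_jumps f >]}.

HB.instance Definition _ := Choice.on monomial.

Lemma monomial_inj (m n : monomial) : val m =1 val n -> m = n.
Proof. by move=> mn; apply/val_inj/funext. Qed.

Lemma monomial_of f : finite_jumps f -> exists m : monomial, val m = f.
Proof.
by move=> /asboolP fP; exists (exist (fun f => `[< finite_jumps f >]) f fP).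
Qed.

Definition monomial1 : monomial :=
  exist (fun f => `[< finite_jumps f >]) _ (asboolT (finite_jumps0 W)).

Definition monomialM (m n : monomial) : monomial :=
  exist (fun f => `[< finite_jumps f >]) _
    (asboolT (finite_jumps_op (op := addn) erefl
      (asboolW (valP m)) (asboolW (valP n)))).

Fact monomialA : associative monomialM.
Proof. by move=> m n p; apply: monomial_inj => x; rewrite /= addnA. Qed.

Fact monomialC : commutative monomialM.
Proof. by move=> m n; apply: monomial_inj => x; rewrite /= addnC. Qed.

Fact monomial1m : left_id monomial1 monomialM.
Proof. by move=> m; apply: monomial_inj. Qed.

Fact monomialm1 : right_id monomial1 monomialM.
Proof. by move=> m; rewrite monomialC monomial1m. Qed.

Fact monomial_unit (m n : monomial) :
  monomialM m n = monomial1 -> m = monomial1 /\ n = monomial1.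
Proof.
move=> mn; have E x : (val m x + val n x == 0)%N.
  by have /(congr1 val)/(congr1 (fun f => f x))/= -> := mn.
by split; apply: monomial_inj => x; have := E x; rewrite addn_eq0 =>
  /andP[/eqP ? /eqP ?].
Qed.

HB.instance Definition _ := Choice_isMonomialDef.Build monomial
  monomialA monomial1m monomialm1 monomial_unit.
HB.instance Definition _ := MonomialDef_isConomialDef.Build monomial monomialC.

Local Notation A := {malg int[monomial]}.
Implicit Types (f g h : A) (m n k : monomial).

(** The product of the least monomials of [f] and [g] for a term order is not
    cancelled, as it is the product of monomials of [f] and [g] in one way only.
    With [wt] equal to 0 this shows that the algebra is a domain; with evaluation
    at a point, that the valuation at this point is multiplicative. *)
Lemma msuppM_extremal (wt : (node W -> nat) -> nat) f g :
    (forall u v, wt (fun x => u x + v x)%N = (wt u + wt v)%N) ->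
    f != 0 -> g != 0 ->
  exists m n, [/\ m \in msupp f, n \in msupp g,
    forall k, k \in msupp f -> (wt (val m) <= wt (val k))%N,
    forall k, k \in msupp g -> (wt (val n) <= wt (val k))%N
    & mmul m n \in msupp (f * g)].
Proof.
move=> /term_order[lt [lt_irr lt_trans lt_total ltD lt_wt]].
have minS (s : seq monomial) : s != [::] -> exists2 m, m \in s &
    forall k, k \in s -> k = m \/ lt (val m) (val k).
  elim: s => [//|a s IH] _; have [s0|/IH[m ms mP]] := eqVneq s [::].
    by exists a; rewrite s0 ?mem_head // => k; rewrite inE => /eqP; left.
  have [am|/eqP am] := eqVneq a m.
    exists m; first by rewrite inE ms orbT.
    by move=> k; rewrite inE => /orP[/eqP->|/mP //]; left.
  have [|lam|lma] := lt_total (val a) (val m).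
    by move=> E; apply: am; apply: val_inj.
    exists a; first exact: mem_head.
    move=> k; rewrite inE => /orP[/eqP|/mP[->|mk]]; [by left|by right|right].
    exact: lt_trans lam mk.
  exists m; first by rewrite inE ms orbT.
  by move=> k; rewrite inE => /orP[/eqP->|/mP //]; right.
have minP h : h != 0 -> exists2 m, m \in msupp h &
    forall k, k \in msupp h -> k = m \/ lt (val m) (val k).
  rewrite -msupp_eq0 => h0; apply: (minS (enum_fset (msupp h))).
  apply: contraNneq h0 => h0; apply/eqP/fsetP => k.
  by rewrite -[LHS]/(k \in enum_fset _) h0.
move=> /minP[m mf mP] /minP[n ng nP]; exists m, n; split=> // [k /mP|k /nP|].
- by case=> [->|/lt_wt].
- by case=> [->|/lt_wt].
have ltmn k l : k \in msupp f -> l \in msupp g -> mmul k l = mmul m n ->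
    k = m /\ l = n.
  have comm (p q : monomial) :
      (fun x => val p x + val q x)%N = (fun x => val q x + val p x)%N.
    by apply: funext => x; rewrite addnC.
  move=> /mP[->|mk] /nP[->|nl] //= /(congr1 val) E; exfalso.
  - apply: (lt_irr (val (mmul m n))); rewrite -{2}E.
    by have := ltD _ _ (val m) nl; rewrite ![(fun x => _ + val m x)%N]comm.
  - by apply: (lt_irr (val (mmul m n))); rewrite -{2}E; exact: ltD mk.
  - apply: (lt_irr (val (mmul m n))); rewrite -{2}E.
    apply: lt_trans (ltD _ _ (val n) mk) _.
    by have := ltD _ _ (val k) nl; rewrite ![(fun x => _ + val k x)%N]comm.
rewrite -mcoeff_neq0 mcoeffMl (bigD1_seq m) ?fset_uniq //=.
rewrite (bigD1_seq n) ?fset_uniq //= eqxx mulr1n.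
rewrite big1_seq ?addr0 => [|l /andP[ln lg]]; last first.
  by case: eqP => // /(ltmn _ _ mf lg)[_ E]; rewrite E eqxx in ln.
rewrite big1_seq ?addr0 => [|k /andP[km kf]]; last first.
  rewrite big1_seq // => l /andP[_ lg].
  by case: eqP => // /(ltmn _ _ kf lg)[E _]; rewrite E eqxx in km.
by rewrite mulf_neq0 // mcoeff_neq0.
Qed.

Definition monomial_ring := {malg int[monomial]}.

HB.instance Definition _ := GRing.ComNzRing.on monomial_ring.

Fact monomial_ring_integral : GRing.integral_domain_axiom monomial_ring.
Proof.
move=> f g fg0; apply/norP => -[f0 g0].
have [//|m [n [_ _ _ _]]] := msuppM_extremal (wt := fun=> 0%N) _ f0 g0.
by rewrite [X in msupp X]fg0 msupp0.
Qed.

HB.instance Definition _ := GRing.ComNzRing_hasMulInverse.Build monomial_ring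
  (@classical_mulVr monomial_ring) (@classical_unitPl monomial_ring)
  (@classical_inv_out monomial_ring).
HB.instance Definition _ := GRing.ComUnitRing_isIntegral.Build monomial_ring
  monomial_ring_integral.

Implicit Types (p q : monomial_ring) (u v : node W -> nat).

Definition supp_ge (p : monomial_ring) u :=
  forall m, m \in msupp (p : A) -> forall x, (u x <= val m x)%N.

(** [u] is the pointwise minimum of the monomials of [p].  It need not be one of
    them. *)
Definition is_content (p : monomial_ring) u :=
  supp_ge p u /\ forall x, exists2 m, m \in msupp (p : A) & val m x = u x.

Lemma is_content_max p u v : is_content p u ->
  (supp_ge p v <-> forall x, (v x <= u x)%N).
Proof.
move=> [uge uat]; split=> [vge x|vu m mp x]; last exact: leq_trans (uge m mp x).
by have [m mp <-] := uat x; apply: vge.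
Qed.

Lemma content_exists p : exists u, finite_jumps u /\ (p != 0 -> is_content p u).
Proof.
have [->|p0] := eqVneq p 0.
  by exists (fun=> 0%N); split=> //; exact: finite_jumps0.
have minS (s : seq monomial) : s != [::] -> exists u, [/\ finite_jumps u,
    forall m, m \in s -> forall x, (u x <= val m x)%N &
    forall x, exists2 m, m \in s & val m x = u x].
  elim: s => [//|a s IH] _; have aF : finite_jumps (val a) := asboolW (valP a).
  have [->|/IH[u [uF uge uat]]] := eqVneq s [::].
    exists (val a); split=> // [m|x]; first by rewrite inE => /eqP ->.
    by exists a; rewrite ?mem_head.
  exists (fun x => minn (val a x) (u x)); split=> [|m|x].
  - exact: (finite_jumps_op (op := minn)).
  - rewrite inE => /orP[/eqP ->|ms] x; first exact: geq_minl.
    by apply: leq_trans (uge m ms x); exact: geq_minr.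
  - have [m ms mx] := uat x; have [ax|ux] := leqP (val a x) (u x).
      by exists a; rewrite ?mem_head.
    by exists m; rewrite // inE ms orbT.
have [|u [uF uge uat]] := minS (enum_fset (msupp (p : A))); last by exists u.
move: p0; rewrite -[_ == 0](msupp_eq0 (p : A)); apply: contraNneq => s0.
by apply/eqP/fsetP => k; rewrite -[LHS]/(k \in enum_fset _) s0.
Qed.

Definition content p : node W -> nat := sval (cid (content_exists p)).

Lemma finite_jumps_content p : finite_jumps (content p).
Proof. by rewrite /content; case: cid => u []. Qed.

Lemma contentP p : p != 0 -> is_content p (content p).
Proof. by rewrite /content; case: cid => u []. Qed.

Lemma content_uniq p u : p != 0 -> is_content p u -> content p = u.
Proof.
move=> p0 pu; have pc := contentP p0; apply: funext => x; apply/anti_leq.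
by rewrite (is_content_max _ pu).1 ?(is_content_max _ pc).1 //; [case: pu|case: pc].
Qed.

Lemma supp_geE p u : p != 0 -> supp_ge p u <-> forall x, (u x <= content p x)%N.
Proof. by move=> p0; exact/is_content_max/contentP. Qed.

Lemma supp_ge_content p : supp_ge p (content p).
Proof.
have [->|/contentP[]//] := eqVneq p 0.
by move=> m; rewrite [msupp _](@msupp0 monomial int).
Qed.

Lemma supp_geD p q u : supp_ge p u -> supp_ge q u -> supp_ge (p + q) u.
Proof.
move=> pu qu m /(fsubsetP (msuppD_le _ _)); rewrite in_fsetU.
by move=> /orP[/pu|/qu].
Qed.

Lemma supp_geN p u : supp_ge p u -> supp_ge (- p) u.
Proof. by move=> pu m; rewrite [msupp _](msuppN (p : A)); apply: pu. Qed.

Lemma supp_geM p q u v : supp_ge p u -> supp_ge q v ->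
  supp_ge (p * q) (fun x => u x + v x)%N.
Proof.
move=> pu qv m /msuppM_le[k [l [kp lq ->]]] x.
by rewrite leq_add ?pu ?qv.
Qed.

Lemma contentM p q : p != 0 -> q != 0 ->
  forall x, content (p * q) x = (content p x + content q x)%N.
Proof.
move=> p0 q0; have pq0 : p * q != 0 by rewrite mulf_neq0.
suff /(content_uniq pq0) -> :
  is_content (p * q) (fun x => content p x + content q x)%N by [].
split=> [|x]; first by apply: supp_geM; exact: supp_ge_content.
have [//|m [n [mp nq mmin nmin mnpq]]] :=
  msuppM_extremal (wt := fun u => u x) _ p0 q0.
exists (mmul m n) => //=.
have [[pge pat] [qge qat]] := (contentP p0, contentP q0).
have [k kp kx] := pat x; have [l lq lx] := qat x.
congr (_ + _)%N; apply/anti_leq; rewrite ?pge ?qge // andbT.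
  by rewrite -kx mmin.
by rewrite -lx nmin.
Qed.

Lemma content_monomial (m : monomial) :
  (<<m>> : A) != 0 /\ content (<<m>> : A) = val m.
Proof.
have m0 : (<<m>> : monomial_ring) != 0.
  rewrite -[_ == 0](msupp_eq0 (<<m>> : A)) msuppU1.
  by apply/fset0Pn; exists m; rewrite inE.
split=> //; apply: content_uniq => //; split=> [k|x].
  by rewrite msuppU1 inE => /eqP ->.
by exists m; rewrite // msuppU1 inE.
Qed.

(** If [n] exceeds the absolute values of the coefficients of [p], no coefficient
    of [p] is cancelled by [n] times a nonzero integer, so the support of
    [p + q *+ n] is the union of those of [p] and [q]. *)
Lemma content_min p q : p != 0 -> q != 0 -> exists n : nat,
  p + q *+ n != 0 /\
  forall x, content (p + q *+ n) x = minn (content p x) (content q x).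
Proof.
move=> p0 q0.
pose N : nat := (\max_(m <- msupp (p : A)) absz (mcoeff m (p : A))).+1.
exists N; set h := p + q *+ N.
have suppE m :
    (m \in msupp (h : A)) = (m \in msupp (p : A)) || (m \in msupp (q : A)).
  rewrite -!mcoeff_neq0 [mcoeff m (h : A)]mcoeffD mcoeffMn.
  have [qm|qm] := eqVneq (mcoeff m (q : A)) 0.
    by rewrite qm mul0rn addr0 orbF.
  rewrite orbT; apply/eqP => E.
  have pm : m \in msupp (p : A).
    rewrite -mcoeff_neq0; apply: contraNneq qm => pm.
    by move: E; rewrite pm add0r => /eqP; rewrite mulrn_eq0.
  have pN : (absz (mcoeff m (p : A)) < N)%N.
    rewrite ltnS; exact: (leq_bigmax_seq m pm isT).
  move/eqP: E; rewrite addr_eq0 => /eqP E; move: pN.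
  rewrite E abszN -mulr_natr abszM natz absz_nat ltnNge leq_pmull //.
  by rewrite absz_gt0.
have h0 : h != 0.
  rewrite -[_ == 0](msupp_eq0 (h : A)); move: p0.
  rewrite -[_ == 0](msupp_eq0 (p : A)) => /fset0Pn[m mp].
  by apply/fset0Pn; exists m; rewrite suppE mp.
split=> //.
suff /(content_uniq h0) -> :
  is_content h (fun x => minn (content p x) (content q x)) by [].
have [[pge pat] [qge qat]] := (contentP p0, contentP q0); split=> [m|x].
  by rewrite suppE => /orP[mp|mq] x; rewrite geq_min;
    [rewrite pge|rewrite qge ?orbT].
have [pq|qp] := leqP (content p x) (content q x).
  by have [m mp mx] := pat x; exists m; rewrite // suppE mp.
by have [m mq mx] := qat x; exists m; rewrite // suppE mq orbT.
Qed.

Fact contentB p q : p != 0 -> q != 0 -> p - q != 0 ->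
  forall x, (minn (content p x) (content q x) <= content (p - q)%R x)%N.
Proof.
move=> p0 q0 pq0; apply/(supp_geE _ pq0); apply: supp_geD; last apply: supp_geN.
  by apply/supp_geE => // x; exact: geq_minl.
by apply/supp_geE => // x; exact: geq_minr.
Qed.

Definition monomial_valuation : valuation_family monomial_ring (node W) :=
  ValuationFamily contentM contentB content_min.

Local Notation R := (kronecker monomial_valuation).

Lemma finite_jumps_kronecker_val (a : R) : finite_jumps (kronecker_val a).
Proof.
by apply: (finite_jumps_op (op := subn)) => //; exact: finite_jumps_content.
Qed.

Lemma kronecker_val_onto u : finite_jumps u ->
  exists2 a : R, a != 0 & kronecker_val a = u.
Proof.
move=> /monomial_of[m <-]; have [m0 <-] := content_monomial m.
exact: (kronecker_embed monomial_valuation m0).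
Qed.

End Monomials.

Local Open Scope order_scope.

(* The ordinal is the order type of [W].  It has to be nonzero: see
   [krull_dim1_mdim_neq0]. *)
Theorem proposition8p13 (d : Order.disp_t) (W : orderType d)
    (W_wo : well_order (<=%O : rel W)) (W_neq0 : inhabited W) :
  exists R : bezoutDomainType,
    has_krull_dim R 1 /\ has_mdim (gamma_pos_inf R) W.
Proof.
pose R : bezoutDomainType := kronecker (monomial_valuation W).
pose v : R -> node W -> nat := @kronecker_val _ _ (monomial_valuation W).
have D_min (f g : node W -> nat) : finite_jumps f -> finite_jumps g ->
  finite_jumps (fun x => minn (f x) (g x)) by exact: finite_jumps_op.
have vM := @kronecker_valM _ _ (monomial_valuation W).
have v_dvd := @kronecker_val_dvd _ _ (monomial_valuation W).
have v_D (a : R) : a != 0%R -> finite_jumps (v a).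
  by move=> _; exact: finite_jumps_kronecker_val.
have v_onto := @kronecker_val_onto _ W.
exists R; split.
  have [w] := W_neq0; have [//|x [_ _ _]] := @exists_child _ _ None w [::].
  have [a a0 aE] := v_onto _ (finite_jumps_cone x).
  apply: (valued_krull_dim1 vM v_dvd v_D v_onto D_min (@finite_jumps_bounded _ W)
    (x0 := x) a0).
  by rewrite [X in (0 < X x)%N]aE in_cone_refl.
apply: (@forest_has_mdim _ W _ (gamma_pos R) (pos_value v)) => //.
- by move=> a b; exact: pos_value_le.
- by move=> a; exact: pos_value_D.
- by move=> f; exact: pos_value_onto.
Qed.
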